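(* For any Borel quasi order $\mathcal{P}=\langle P,\leq\rangle$, exactly one of the following holds: (1) $\mathrm{odim}_B(\mathcal{P})\leq\aleph_0$; (2) for every selector $E$, there exist $f\in\mathcal{F}$ and a continuous $\varphi:2\times[T_f]\to P$ such that both of the following hold: (a) for all $x,y\in[T_f]$, if $\langle 0,x\rangle\leq_{\mathcal{G}_0(E,f)}\langle 1,y\rangle$, then $\varphi(\langle 0,x\rangle)\leq\varphi(\langle 1,y\rangle)$; (b) for every $x\in[T_f]$, $\varphi(\langle 0,x\rangle)$ and $\varphi(\langle 1,x\rangle)$ are $\leq$-incomparable.
   Context: A quasi order on a set $P$ is a reflexive transitive relation $\leq$ on $P$; $\langle P,\leq\rangle$ is then called a quasi order. A partial order is an irreflexive transitive relation. Elements $p,q$ are $\leq$-incomparable if $p\nleq q$ and $q\nleq p$. For a quasi order $\leq$ on $P$: $x \, E_{\leq} \, y$ iff ($x \leq y$ and $y \leq x$); $x<y$ iff ($x\leq y$ and $y \nleq x$); $<$ induces a partial order on $P/E_{\leq}$, also denoted $<$, by $[x]<[y]$ iff $x<y$. A quasi order $\langle P,\leq\rangle$ is Borel if $P$ is a Polish space and $\leq$ is a Borel subset of $P\times P$. A partial order $<'$ on a set $Q$ extends a partial order $<$ on $Q$ if $<\ \subseteq\ <'$. Borel order dimension: let $\mathcal{P}=\langle P,\leq\rangle$ be a Borel quasi order. A partial order $\prec$ on $P/E_{\leq}$ is Borel if there is a Borel quasi order $\preceq$ on $P$ with $E_{\preceq}=E_{\leq}$ such that $\prec$ is the partial order on $P/E_{\preceq}=P/E_{\leq}$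 induced by $\preceq$. $\mathrm{odim}_B(\mathcal{P})$ is the minimal cardinal $\kappa$ such that there is a sequence $\langle <_i : i\in\kappa\rangle$ of Borel partial orders on $P/E_{\leq}$ extending $<$ such that for all $x,y\in P$ there is $i\in\kappa$ with ($[y]<_i[x]$ or $[x]<[y]$ or $[x]=[y]$). Let $\mathcal{F}=\{f\in\omega^\omega:\forall k\, f(k)\geq 2\}$ and $\mathcal{F}_{<\omega}=\bigcup_{l<\omega}\{s\in\omega^l:\forall k<l\ s(k)\geq2\}$. For $\sigma\in\mathcal{F}_{<\omega}$ let $T_{[\sigma]}=\prod_{k\in\mathrm{dom}(\sigma)}\sigma(k)$. For $f\in\mathcal{F}$ let $[T_f]=\prod_{k\in\omega}f(k)$, with the product topology. A selector is a function $E:\mathcal{F}_{<\omega}\to\omega^{<\omega}$ with $E(\sigma)\in T_{[\sigma]}$ for every $\sigma$. For a selector $E$ and $f\in\mathcal{F}$, $\mathcal{G}_0(E,f)=\langle[T_f],R_{E,f}\rangle$, where for $y,z\in[T_f]$, $\langle y,z\rangle\in R_{E,f}$ iff there exist $l\in\omega$ and $x\in\omega^\omega$ such that $z(l)=y(l)+1 \bmod f(l)$, $y=E(f\restriction l)^\frown\langle y(l)\rangle^\frown x$ and $z=E(f\restriction l)^\frown\langle z(l)\rangle^\frown x$. The relation $\leq_{\mathcal{G}_0(E,f)}$ is the quasi order on $2\times[T_f]$ given by: $\langle i,x\rangle\leq_{\mathcal{G}_0(E,f)}\langle j,y\rangle$ iff $\langle i,x\rangle=\langle j,y\rangle$ or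 ($i=0$, $j=1$ and $\langle x,y\rangle\in R_{E,f}$). *)

(* Defs.v *)
From mathcomp Require Import all_boot all_order all_algebra.
From mathcomp Require Import all_classical all_reals topology measure.

Set Implicit Arguments.
Unset Strict Implicit.
Unset Printing Implicit Defensive.

Import Order.TTheory GRing.Theory Num.Theory.

Local Open Scope classical_set_scope.
Local Open Scope ring_scope.
Local Open Scope quotient_scope.

Definition is_metric (R : realType) (T : Type) (d : T -> T -> R) : Prop :=
  [/\ forall x y, 0 <= d x y,
      forall x y, d x y = 0 <-> x = y,
      forall x y, d x y = d y x &
      forall x y z, d x z <= d x y + d y z].

Definition metric_compatible (R : realType) (T : topologicalType)
    (d : T -> T -> R) : Prop :=
  forall x : T, nbhs x = nbhs_ball_ (fun y (e : R) => [set z | d y z < e]) x.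

Definition metric_complete (R : realType) (T : topologicalType)
    (d : T -> T -> R) : Prop :=
  forall u : nat -> T,
    (forall e : R, 0 < e ->
       exists N : nat, forall m n : nat,
         (N <= m)%N -> (N <= n)%N -> d (u m) (u n) < e) ->
    exists x : T, u @ \oo --> x.

(* The empty space is Polish here: topologicalType does not require a point,
   unlike completeType and completePseudoMetricType. *)
Definition polish (R : realType) (T : topologicalType) : Prop :=
  (exists2 D : set T, countable D & dense D) /\
  (exists d : T -> T -> R,
     [/\ is_metric d, metric_compatible d & metric_complete d]).

Definition borel_set (T : topologicalType) : set (set T) := <<s @open T >>.

(* Relations are boolean, as everywhere in MathComp; with the classical axioms
   of boolp this covers all relations. *)
Record quasi_order (T : Type) := QuasiOrder {
  qo_rel :> rel T;
  qo_refl : reflexive qo_rel;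
  qo_trans : transitive qo_rel }.

Definition borel_quasi_order (T : topologicalType) (le : quasi_order T) : Prop :=
  borel_set [set xy : T * T | le xy.1 xy.2].

Section Quotient.
Context {T : choiceType}.
Implicit Types (le : quasi_order T) (x y : T).

Definition qo_equiv le : rel T := fun x y => le x y && le y x.

Definition qo_lt le : rel T := fun x y => le x y && ~~ le y x.

Definition incomparable le x y : bool := ~~ le x y && ~~ le y x.

Lemma qo_equiv_refl le : reflexive (qo_equiv le).
Proof. by move=> x; rewrite /qo_equiv qo_refl. Qed.

Lemma qo_equiv_sym le : symmetric (qo_equiv le).
Proof. by move=> x y; rewrite /qo_equiv andbC. Qed.

Lemma qo_equiv_trans le : transitive (qo_equiv le).
Proof.
move=> y x z /andP[xy yx] /andP[yz zy].
by rewrite /qo_equiv (qo_trans xy yz) (qo_trans zy yx).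
Qed.

Definition qo_equiv_rel le : equiv_rel T :=
  EquivRel (qo_equiv le) (qo_equiv_refl le) (qo_equiv_sym le)
    (qo_equiv_trans (le := le)).

Definition qo_quot le := {eq_quot (qo_equiv_rel le)}.

Definition qo_class le x : qo_quot le := \pi_(qo_quot le) x.

Definition quot_lt le : rel (qo_quot le) :=
  fun a b => qo_lt le (repr a) (repr b).

Lemma quot_ltE le x y : quot_lt (qo_class le x) (qo_class le y) = qo_lt le x y.
Proof.
have cr z : qo_equiv le (repr (qo_class le z)) z.
  have := reprK (qo_class le z).
  by rewrite {2}/qo_class => /(@eqmodP _ (qo_equiv_rel le)).
rewrite /quot_lt /qo_lt.
case/andP: (cr x) => ax xa; case/andP: (cr y) => by_ yb.
congr (_ && ~~ _); apply/idP/idP => h.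
- exact: qo_trans xa (qo_trans h by_).
- exact: qo_trans ax (qo_trans h yb).
- exact: qo_trans yb (qo_trans h ax).
- exact: qo_trans by_ (qo_trans h xa).
Qed.

End Quotient.

Definition partial_order (Q : Type) (lt : rel Q) : Prop :=
  irreflexive lt /\ transitive lt.

(* [le'] has the same classes as [le], so the order it induces on its own
   quotient is read on the classes of [le]. *)
Definition borel_partial_order (P : topologicalType) (le : quasi_order P)
    (lt : rel (qo_quot le)) : Prop :=
  partial_order lt /\
  exists le' : quasi_order P,
    [/\ borel_quasi_order le',
        qo_equiv le' =2 qo_equiv le &
        forall x y, lt (qo_class le x) (qo_class le y) = qo_lt le' x y].

Definition odimB_witness (P : topologicalType) (le : quasi_order P)
    (K : Type) : Prop :=
  exists lt_ : K -> rel (qo_quot le),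
    (forall i, borel_partial_order (lt_ i) /\
               subrel (@quot_lt _ le) (lt_ i)) /\
    (forall x y : P, exists i : K,
       [\/ lt_ i (qo_class le y) (qo_class le x),
           quot_lt (qo_class le x) (qo_class le y) |
           qo_class le x = qo_class le y]).

(* Cardinals are represented by types, compared by injections: [K] has the
   least cardinality among the index types of witnessing families. *)
Definition is_odimB (P : topologicalType) (le : quasi_order P)
    (K : Type) : Prop :=
  odimB_witness le K /\
  forall K' : Type, odimB_witness le K' -> ([set: K] #<= [set: K'])%card.

Definition odimB_le_aleph0 (P : topologicalType) (le : quasi_order P) : Prop :=
  exists K : Type, is_odimB le K /\ ([set: K] #<= [set: nat])%card.

Definition Fomega : set (nat -> nat) := [set f | forall k, (2 <= f k)%N].

Definition Ffin : set (seq nat) :=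
  [set s | forall k, (k < size s)%N -> (2 <= nth 0%N s k)%N].

Definition Tfin (s : seq nat) : set (seq nat) :=
  [set t | size t = size s /\
           forall k, (k < size s)%N -> (nth 0%N t k < nth 0%N s k)%N].

(* Only the values on [Ffin] are constrained, and only those are ever used. *)
Definition selector (E : seq nat -> seq nat) : Prop :=
  forall s, Ffin s -> Tfin s (E s).

Definition Tbranch (f : nat -> nat) : Type :=
  prod_topology (fun k : nat => discrete_topology 'I_(f k)).

Definition Tseq (f : nat -> nat) (y : Tbranch f) : nat -> nat :=
  fun k => nat_of_ord (y k : 'I_(f k)).

Definition restrict_seq (f : nat -> nat) (l : nat) : seq nat := mkseq f l.

Definition cat_stream (s : seq nat) (x : nat -> nat) : nat -> nat :=
  fun k => if (k < size s)%N then nth 0%N s k else x (k - size s)%N.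

Definition G0_edge (E : seq nat -> seq nat) (f : nat -> nat)
    (y z : Tbranch f) : Prop :=
  exists (l : nat) (x : nat -> nat),
    [/\ Tseq z l = ((Tseq y l).+1 %% f l)%N,
        Tseq y = cat_stream (E (restrict_seq f l) ++ [:: Tseq y l]) x &
        Tseq z = cat_stream (E (restrict_seq f l) ++ [:: Tseq z l]) x].

(* The first factor 2 = {0, 1} is [bool], with 0 = false and 1 = true. *)
Definition G0_le (E : seq nat -> seq nat) (f : nat -> nat)
    (p q : bool * Tbranch f) : Prop :=
  p = q \/ [/\ p.1 = false, q.1 = true & G0_edge E p.2 q.2].

Definition G0_map (P : topologicalType) (le : quasi_order P)
    (E : seq nat -> seq nat) : Prop :=
  exists f : nat -> nat, Fomega f /\
  exists phi : bool * Tbranch f -> P,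
    [/\ continuous phi,
        forall x y : Tbranch f,
          G0_le E (false, x) (true, y) -> le (phi (false, x)) (phi (true, y)) &
        forall x : Tbranch f, incomparable le (phi (false, x)) (phi (true, x))].

(* Main.v *)
Require Import Defs.
From mathcomp Require Import all_boot all_order all_algebra.
From mathcomp Require Import all_classical all_reals topology measure.
From mathcomp Require Import lra.

(** Call a set S of pairs acyclic for le when no closed walk alternates steps of
    le with steps of S.  Both halves of the dichotomy turn on whether the set of
    incomparable pairs is covered by countably many acyclic Borel sets.

    If S is acyclic and analytic, then le and S generate an analytic quasi order
    with the same classes as le.  Lusin separation enlarges an analytic acyclic
    set to a Borel acyclic one ([acyclic_borel_hull]): there is no cycle of length
    n exactly when one occurrence of S is disjoint from the converse of the
    relation formed by the rest of the cycle, which is analytic.  Alternating this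
    enlargement with closure under composition yields, in the limit, a Borel
    quasi order extending le with the same classes and containing S strictly
    ([acyclic_borel_extension]).  Thus a countable cover of the incomparable
    pairs by acyclic Borel sets makes the Borel order dimension countable.

    Suppose there is no such cover, and fix a selector E.  A finite tree with
    branching numbers s has a finite version of the graph G_0(E, f), whose edges
    are those decided before level |s|; consider the set of its homomorphisms
    into the graph on incomparable pairs (y, x) with an edge from (y, x) to
    (y', x') when x <= y'.  Call a set of homomorphisms small when it is covered
    by countably many sets of the form: the vertex v is sent into the acyclic
    Borel set B.  The key point ([glue_large]) is that if A is analytic and not
    small, then for some n >= 2 the set of n-tuples from A whose values at
    E(s) form a cycle is a set of homomorphisms for the next level that is not
    small either; otherwise one could remove countably many small sets from
    A, and the values at E(s) of what remains, being an analytic acyclic set,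
    would lie in a Borel acyclic one.  This chooses the branching numbers f one
    at a time.  Homomorphisms carry codes in the Baire space for their vertices
    and for witnesses of their edges; as smallness is a sigma-ideal, more and
    more digits of these codes can be fixed along the way, and the limits of the
    codes define the required continuous map ([limit_G0_map]).

    The two alternatives exclude each other by Baire category.  For a selector
    whose values are dense in every tree, given countably many Borel extensions
    of le, the branches x at which extension i puts phi(1, x) strictly below
    phi(0, x) cover the space, so for some i they are comeager in some cylinder;
    a level l whose selected node lies in that cylinder then carries a full cycle
    of f(l) edges inside this set, which gives an element strictly below itself
    ([countable_odim_no_dense_map]). *)

Set Implicit Arguments.
Unset Strict Implicit.
Unset Printing Implicit Defensive.

Import Order.TTheory GRing.Theory Num.Theory.

Local Open Scope classical_set_scope.
Local Open Scope card_scope.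

(** * Countable products of discrete spaces, and analytic sets *)

Notation dprod K := (prod_topology (fun i => discrete_topology (K i))).
Notation bspace J := (prod_topology (fun _ : J => discrete_topology nat)).
Notation baire := (bspace nat).

Section DiscreteProducts.
Variables (I : eqType) (K : I -> choiceType).

Lemma dprod_cvg (F : set_system (dprod K)) (FF : Filter F) (y : dprod K) :
  (forall i, F [set x | x i = y i]) -> F --> y.
Proof.
move=> Fy; apply/cvg_sup => i U [V] [[W oW <-] WfN WU].
by rewrite nbhs_filterE; apply: filterS WU _; apply: filterS (Fy i) => x /= ->.
Qed.

Lemma dprod_near (y : dprod K) i : \forall x \near y, x i = y i.
Proof.
have := @proj_continuous I (fun i => discrete_topology (K i)) i y.
by move=> /(_ [set y i]); apply; exact: discrete_set1.
Qed.

Lemma continuous_to_dprod (X : topologicalType) (f : X -> dprod K) :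
  (forall i x, \forall z \near x, f z i = f x i) -> continuous f.
Proof. by move=> fc x; apply: dprod_cvg => i; exact: fc. Qed.

Lemma hausdorff_dprod : hausdorff_space (dprod K).
Proof.
apply: (@hausdorff_product I (fun i => discrete_topology (K i))) => i.
exact: discrete_hausdorff.
Qed.

End DiscreteProducts.

(** Cylinders given by initial segments form a neighbourhood basis: otherwise a
    sequence of points outside U agreeing with y on longer and longer segments
    would converge to y. *)
Lemma dprod_nbhs (K : nat -> choiceType) (y : dprod K) (U : set (dprod K)) :
  nbhs y U -> exists n, forall x : dprod K,
    (forall j, (j < n)%N -> x j = y j) -> U x.
Proof.
move=> yU; apply: contrapT => /forallNP nU.
have /choice[u uP] : forall n, exists x : dprod K,
    (forall j, (j < n)%N -> x j = y j) /\ ~ U x.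
  move=> n; have /existsNP[x /not_implyP[xy xU]] := nU n.
  by exists x.
have : u @ \oo --> y.
  apply: dprod_cvg => i; exists i.+1 => // n /= lin.
  by have [-> ] := uP n.
move=> /(_ _ yU)[N _ /(_ N)/=/(_ (leqnn N))].
by have [_] := uP N.
Qed.

Lemma near_cylinder (K : nat -> choiceType) (y : dprod K) n :
  \forall x \near y, forall j, (j < n)%N -> x j = y j.
Proof.
elim: n => [|n IH].
  by apply: (@filterE _ _ (@nbhs_filter (dprod K) y)) => x j; rewrite ltn0.
apply: (@filterS2 _ _ (@nbhs_filter (dprod K) y)) IH (dprod_near y n) => x xn xyn j.
by rewrite ltnS leq_eqVlt => /orP[/eqP->|/xn].
Qed.

Lemma continuous_reindex (I J : eqType) (r : J -> I) :
  continuous (fun x : bspace I => (fun j => x (r j)) : bspace J).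
Proof. by apply: continuous_to_dprod => j x; exact: dprod_near. Qed.

Lemma continuous_pair (X Y Z : topologicalType) (f : X -> Y) (g : X -> Z) :
  continuous f -> continuous g -> continuous (fun x => (f x, g x)).
Proof. by move=> fc gc x; apply: cvg_pair; [exact: fc|exact: gc]. Qed.

Lemma continuous_fst (Y Z : topologicalType) : continuous (@fst Y Z).
Proof. by move=> x; exact: cvg_fst. Qed.

Lemma continuous_snd (Y Z : topologicalType) : continuous (@snd Y Z).
Proof. by move=> x; exact: cvg_snd. Qed.

Lemma continuous_o (X Y Z : topologicalType) (f : X -> Y) (g : Y -> Z) :
  continuous g -> continuous f -> continuous (fun x => g (f x)).
Proof. by move=> gc fc x; apply: continuous_comp; [exact: fc|exact: gc]. Qed.

Lemma hausdorff_disjoint_nbhs (X : topologicalType) (x y : X) :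
  hausdorff_space X -> x <> y -> exists U V : set X,
  [/\ open U, open V, U x, V y & forall z, U z -> ~ V z].
Proof.
rewrite open_hausdorff => hX /eqP /hX[[U V]] /=.
rewrite !inE => -[Ux Vy] [oU oV UV0]; exists U, V; split=> // z Uz Vz.
have : (U `&` V) z by split.
by have -> : U `&` V = set0 := UV0.
Qed.

Lemma closed_eq (X Y : topologicalType) (f g : X -> Y) : hausdorff_space Y ->
  continuous f -> continuous g -> closed [set x | f x = g x].
Proof.
move=> hY fc gc; rewrite -openC openE => x /= xy.
have [U [V [oU oV Ux Vx UV0]]] := hausdorff_disjoint_nbhs hY xy.
have nU : nbhs x (f @^-1` U) by apply: fc; apply: open_nbhs_nbhs.
have nV : nbhs x (g @^-1` V) by apply: gc; apply: open_nbhs_nbhs.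
rewrite /interior; apply: filterS2 nU nV => z /= Uz Vz e.
by apply: (UV0 (f z)) => //; rewrite e.
Qed.

Lemma closed_preimage (X Y : topologicalType) (f : X -> Y) (C : set Y) :
  continuous f -> closed C -> closed (f @^-1` C).
Proof. by move=> fc cC; apply: closed_comp => // x _; exact: fc. Qed.

Lemma hausdorff_prod (X Y : topologicalType) :
  hausdorff_space X -> hausdorff_space Y -> hausdorff_space (X * Y)%type.
Proof.
move=> hX hY [x y] [x' y'] /= xy.
have -> : x = x'.
  apply: hX => U V xU x'V.
  have [] := xy (fst @^-1` U) (fst @^-1` V).
  - by apply: (@continuous_fst X Y (x, y)).
  - by apply: (@continuous_fst X Y (x', y')).
  by move=> z [? ?]; exists z.1.
have -> // : y = y'.
apply: hY => U V xU x'V.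
have [] := xy (snd @^-1` U) (snd @^-1` V).
- by apply: (@continuous_snd X Y (x, y)).
- by apply: (@continuous_snd X Y (x', y')).
by move=> z [? ?]; exists z.2.
Qed.

Lemma closed_baire (C : set baire) (x : baire) : closed C ->
  (forall n, exists2 z, C z & forall j, (j < n)%N -> z j = x j) -> C x.
Proof.
move=> cC Cx; apply: cC => U /dprod_nbhs[n nU].
by have [z Cz zx] := Cx n; exists z; split=> //; exact: nU.
Qed.

Definition stem (s : seq nat) : set baire := [set x | mkseq x (size s) = s].

Lemma mem_stem (x : baire) n : stem (mkseq x n) x.
Proof. by rewrite /stem /= size_mkseq. Qed.

Lemma stem_mkseq (x y : baire) n : stem (mkseq x n) y ->
  forall j, (j < n)%N -> y j = x j.
Proof.
rewrite /stem /= size_mkseq => yx j jn.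
by have := congr1 (nth 0%N ^~ j) yx; rewrite /= !nth_mkseq.
Qed.

Section Analytic.

(** Parametrising by a closed subset of the Baire space with a total map covers
    the empty set and avoids extending maps from closed subsets. *)
Definition analytic (X : topologicalType) (A : set X) : Prop :=
  exists (C : set baire) (f : baire -> X),
    [/\ closed C, continuous f & A = f @` C].

(** Encoding J in the natural numbers lets every construction below take
    parameters in whichever countable power of the natural numbers is natural. *)
Lemma analytic_bspace (J : countType) (X : topologicalType) (C : set (bspace J))
    (f : bspace J -> X) :
  closed C -> continuous f -> analytic (f @` C).
Proof.
move=> cC fc; pose r : baire -> bspace J := fun x j => x (pickle j).
have rc : continuous r by exact: continuous_reindex.
exists (r @^-1` C), (fun x => f (r x)); split.
- exact: closed_preimage.
- exact: continuous_o.
rewrite eqEsubset; split=> [_ [z Cz <-]|_ [x Cx <-]]; last by exists (r x).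
pose x : baire := fun n => oapp z 0%N (unpickle n).
have rx : r x = z by apply: funext => j; rewrite /r /x pickleK.
by exists x; rewrite /= rx.
Qed.

Lemma analytic_image (X Y : topologicalType) (g : X -> Y) (A : set X) :
  continuous g -> analytic A -> analytic (g @` A).
Proof.
move=> gc [C [f [cC fc ->]]]; exists C, (fun x => g (f x)).
split=> //; first exact: continuous_o.
by rewrite image_comp.
Qed.

(** The coordinate None of a parameter says which set it describes. *)
Lemma analytic_bigcup (X : topologicalType) (A : nat -> set X) :
  (forall n, analytic (A n)) -> analytic (\bigcup_n A n).
Proof.
move=> /choice[C /choice[f AP]].
pose r : bspace (option nat) -> baire := fun x n => x (Some n).
have rc : continuous r by exact: continuous_reindex.
pose g (x : bspace (option nat)) := f (x None : nat) (r x).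
rewrite (_ : \bigcup_n A n = g @` [set x | C (x None : nat) (r x)]); last first.
  rewrite eqEsubset; split=> [x [n _]|_ [z Cz <-]].
    have [_ _ ->] := AP n; case=> z Cz <-.
    pose w : bspace (option nat) := fun j => if j is Some k then z k else n.
    have rw : r w = z by apply: funext.
    by exists w; rewrite /= /g rw.
  by exists (z None : nat) => //; have [_ _ ->] := AP (z None : nat); exists (r z).
apply: analytic_bspace.
  rewrite (_ : [set _ | _] = \bigcap_n (~` [set x | x None = n] `|` r @^-1` C n)).
    apply: closed_bigI => n _; apply: closedU.
      apply: open_closedC; rewrite openE => x /= <-.
      exact: dprod_near.
    by apply: closed_preimage => //; have [] := AP n.
  rewrite eqEsubset; split=> [x Cx n _|x /(_ (x None : nat) I) /= []] //.
  by have [<-|] := pselect (x None = n); [right|left].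
move=> x; have : {for x, continuous (fun y => f (x None : nat) (r y))}.
  by apply: (continuous_o _ rc); have [] := AP (x None : nat).
apply: cvg_trans; apply: near_eq_cvg.
by apply: filterS (dprod_near x None) => y yx; rewrite /g yx.
Qed.

(** A point of the intersection is described by one parameter for each set, the
    described points being equal; equality is a closed condition in a Hausdorff
    space. *)
Lemma analytic_bigcap (X : topologicalType) (A : nat -> set X) :
  hausdorff_space X ->
  (forall n, analytic (A n)) -> analytic (\bigcap_n A n).
Proof.
move=> hX /choice[C /choice[f AP]].
pose r n : bspace (nat * nat)%type -> baire := fun x m => x (n, m).
have rc n : continuous (r n) by exact: continuous_reindex.
have frc n : continuous (fun x => f n (r n x)).
  by apply: (continuous_o _ (rc n)); have [] := AP n.
rewrite (_ : \bigcap_n A n = (fun x => f 0%N (r 0%N x)) @`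
  \bigcap_n (r n @^-1` C n `&` [set x | f n (r n x) = f 0%N (r 0%N x)])).
  apply: analytic_bspace => //; apply: closed_bigI => n _; apply: closedI.
    by apply: closed_preimage => //; have [] := AP n.
  exact: closed_eq.
rewrite eqEsubset; split=> [x Ax|_ [z Cz <-] n _].
  have /choice[u uP] : forall n, exists z, C n z /\ f n z = x.
    move=> n; have := Ax n I; have [_ _ ->] := AP n.
    by case=> z Cz <-; exists z.
  pose w : bspace (nat * nat)%type := fun nm => u nm.1 nm.2.
  have rw n : r n w = u n by apply: funext.
  exists w; last by rewrite rw; have [] := uP 0%N.
  by move=> n _; rewrite /= !rw; have [? ->] := uP n; have [_ ->] := uP 0%N.
have [/= Cn <-] := Cz n I.
by have [_ _ ->] := AP n; exists (r n z).
Qed.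

Definition suslin (X : topologicalType) : Prop :=
  exists p : baire -> X, continuous p /\ forall x, exists z, p z = x.

Lemma suslin_bspace (J : countType) : suslin (bspace J).
Proof.
exists (fun x j => x (pickle j)); split; first exact: continuous_reindex.
move=> z; exists (fun n => oapp z 0%N (unpickle n)).
by apply: funext => j; rewrite pickleK.
Qed.

Lemma suslin_prod (X Y : topologicalType) :
  suslin X -> suslin Y -> suslin (X * Y)%type.
Proof.
move=> [p [pc ps]] [q [qc qs]].
exists (fun x : baire => (p (fun n => x n.*2), q (fun n => x n.*2.+1))); split.
  by apply: continuous_pair;
    [apply: (continuous_o pc)|apply: (continuous_o qc)]; exact: continuous_reindex.
move=> [x y]; have [z <-] := ps x; have [w <-] := qs y.
exists (fun n => if odd n then w n./2 else z n./2).
congr (p _, q _); apply: funext => n /=; first by rewrite odd_double doubleK.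
by rewrite odd_double /= uphalf_double.
Qed.

Lemma analytic_preimage (X Y : topologicalType) (g : X -> Y) (A : set Y) :
  suslin X -> hausdorff_space Y -> continuous g ->
  analytic A -> analytic (g @^-1` A).
Proof.
move=> [p [pc ps]] hY gc [C [f [cC fc ->]]].
pose r b : bspace (bool * nat)%type -> baire := fun x m => x (b, m).
have rc b : continuous (r b) by exact: continuous_reindex.
rewrite (_ : g @^-1` _ = (fun x => p (r false x)) @`
  (r true @^-1` C `&` [set x | f (r true x) = g (p (r false x))])).
  have prc : continuous (fun x => p (r false x)) := continuous_o pc (rc false).
  apply: analytic_bspace => //; apply: closedI; first exact: closed_preimage.
  apply: closed_eq => //; first exact: (continuous_o fc).
  exact: (continuous_o gc).
rewrite eqEsubset; split=> [x [z Cz fz]|_ [x [/= Cx e] <-]]; last first.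
  by exists (r true x).
have [y yx] := ps x.
pose w : bspace (bool * nat)%type := fun bn => if bn.1 then z bn.2 else y bn.2.
have rt : r true w = z by apply: funext.
have rf : r false w = y by apply: funext.
by exists w; rewrite /= ?rt rf ?yx.
Qed.

Lemma analytic_closed (X : topologicalType) (A : set X) :
  suslin X -> closed A -> analytic A.
Proof.
move=> [p [pc ps]] cA; exists (p @^-1` A), p; split=> //.
  exact: closed_preimage.
rewrite eqEsubset; split=> [x Ax|_ [z Az <-] //].
by have [z zx] := ps x; exists z; rewrite /= ?zx.
Qed.

Lemma analytic_setI (X : topologicalType) (A B : set X) :
  hausdorff_space X -> analytic A -> analytic B -> analytic (A `&` B).
Proof.
move=> hX aA aB.
rewrite (_ : A `&` B = \bigcap_n (if n is 0%N then A else B)).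
  by apply: analytic_bigcap => // -[].
rewrite eqEsubset; split=> [x [Ax Bx] [|n] _|x ABx] //.
by split; [exact: (ABx 0%N)|exact: (ABx 1%N)].
Qed.

Lemma borel_ind (X : topologicalType) (Q : set X -> Prop) :
  (forall A, open A -> Q A) -> (forall A, Q A -> Q (~` A)) ->
  (forall A : nat -> set X, (forall n, Q (A n)) -> Q (\bigcup_n A n)) ->
  forall B, borel_set B -> Q B.
Proof.
move=> Qo QC QU; apply: smallest_sub => //; split=> //.
- by apply: Qo; exact: open0.
- by move=> A QA; rewrite setTD; exact: QC.
Qed.

(** The preimage of an open set in the Baire space is a countable union of
    basic clopen sets, whose images are analytic. *)
Lemma analytic_open (X : topologicalType) (A : set X) :
  suslin X -> open A -> analytic A.
Proof.
move=> sX oA; have [p [pc ps]] := sX.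
have cstem s : closed (stem s).
  rewrite -openC openE => x /= xs; rewrite /interior.
  apply: (@filterS _ _ (@nbhs_filter baire x)) (near_cylinder x (size s)) => y yx ys.
  apply: xs; rewrite /stem /= -{2}ys /mkseq; apply/eq_in_map => i.
  by rewrite mem_iota add0n => /yx.
pose F n : set baire := if (unpickle n : option (seq nat)) is Some s then
   (if `[< stem s `<=` p @^-1` A >] then stem s else set0) else set0.
have -> : A = \bigcup_n (p @` F n).
  rewrite eqEsubset; split=> [x Ax|x [n _ [z]]].
    have [z zx] := ps x.
    have : nbhs z (p @^-1` A) by apply: pc; apply: open_nbhs_nbhs; split=> //; rewrite zx.
    move=> /dprod_nbhs[n nA]; exists (pickle (mkseq z n)) => //.
    exists z => //; rewrite /F pickleK; case: asboolP => [_|]; first exact: mem_stem.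
    by case=> y /stem_mkseq; exact: nA.
  rewrite /F; case: (unpickle n) => [s|] //.
  by case: asboolP => // sA /sA /= + <-.
apply: analytic_bigcup => n; apply: analytic_image => //.
apply: (analytic_closed (suslin_bspace _)).
rewrite /F; case: (unpickle n) => [s|]; last exact: closed0.
by case: asboolP => _ //; exact: closed0.
Qed.

(** The sets that are analytic together with their complement form a
    sigma-algebra containing the open sets. *)
Lemma analytic_borel (X : topologicalType) (B : set X) :
  suslin X -> hausdorff_space X -> borel_set B -> analytic B.
Proof.
move=> sX hX bB; suff [] : analytic B /\ analytic (~` B) by [].
move: B bB; apply: borel_ind => [A oA|A [aA aCA]|A aA].
- by split; [exact: analytic_open|exact/analytic_closed/open_closedC].
- by split=> //; rewrite setCK.
- split; first by apply: analytic_bigcup => n; have [] := aA n.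
  by rewrite setC_bigcup; apply: analytic_bigcap => // n; have [] := aA n.
Qed.

End Analytic.

(** * Borel sets and the Lusin separation theorem *)

Section BorelSets.
Variable X : topologicalType.
Implicit Types A B : set X.

Lemma borel_open A : open A -> borel_set A.
Proof. exact: sub_sigma_algebra. Qed.

Lemma borel_setC A : borel_set A -> borel_set (~` A).
Proof. by move=> /sigma_algebraCD; rewrite setTD. Qed.

Lemma borel_bigcup (A : nat -> set X) :
  (forall n, borel_set (A n)) -> borel_set (\bigcup_n A n).
Proof. exact: sigma_algebra_bigcup. Qed.

Lemma borel_bigcap (A : nat -> set X) :
  (forall n, borel_set (A n)) -> borel_set (\bigcap_n A n).
Proof.
move=> bA; rewrite -[X in borel_set X]setCK setC_bigcap; apply: borel_setC.
by apply: borel_bigcup => n; exact: borel_setC.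
Qed.

Lemma borel_setT : borel_set (@setT X).
Proof. by apply: borel_open; exact: openT. Qed.

Lemma borel_set0 : borel_set (@set0 X).
Proof. by apply: borel_open; exact: open0. Qed.

Lemma borel_setU A B : borel_set A -> borel_set B -> borel_set (A `|` B).
Proof.
move=> bA bB; rewrite -bigcup2E; apply: borel_bigcup => -[|[|n]] //=.
exact: borel_set0.
Qed.

Lemma borel_setI A B : borel_set A -> borel_set B -> borel_set (A `&` B).
Proof.
move=> bA bB; rewrite -[A]setCK -[B]setCK -setCU.
apply: borel_setC; apply: borel_setU; exact: borel_setC.
Qed.

End BorelSets.

Lemma borel_preimage (X Y : topologicalType) (f : X -> Y) (B : set Y) :
  continuous f -> borel_set B -> borel_set (f @^-1` B).
Proof.
move=> fc; move: B; apply: borel_ind => [A oA|A bA|A bA].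
- by apply: borel_open; move/continuousP: fc; exact.
- exact: borel_setC.
- by rewrite preimage_bigcup; exact: borel_bigcup.
Qed.

Lemma borel_converse (X : topologicalType) (S : set (X * X)) :
  borel_set S -> borel_set [set p | S (p.2, p.1)].
Proof.
exact: borel_preimage (continuous_pair (@continuous_snd X X) (@continuous_fst X X)).
Qed.

Lemma dependent_choice_from (T : Type) (r : T -> T -> Prop) (x0 : T) :
  (forall x, exists y, r x y) ->
  exists f : nat -> T, f 0%N = x0 /\ forall n, r (f n) (f n.+1).
Proof. by move=> /choice[g gP]; exists (fun n => iter n g x0). Qed.

Section Separation.
Variable X : topologicalType.
Implicit Types A B : set X.

Definition borel_separated A B :=
  exists2 S, borel_set S & A `<=` S /\ S `<=` ~` B.

Lemma borel_separated_bigcup (A B : nat -> set X) :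
  (forall n m, borel_separated (A n) (B m)) ->
  borel_separated (\bigcup_n A n) (\bigcup_n B n).
Proof.
move=> AB; have /choice[T TP] : forall nm : nat * nat, exists S,
    [/\ borel_set S, A nm.1 `<=` S & S `<=` ~` B nm.2].
  by move=> [n m]; have [S ? []] := AB n m; exists S.
pose S n m := T (n, m); have SP n m := TP (n, m).
exists (\bigcup_n \bigcap_m S n m).
  by apply: borel_bigcup => n; apply: borel_bigcap => m; have [] := SP n m.
split=> x [n _ Anx].
  by exists n => // m _; have [_ + _] := SP n m; exact.
by move=> [m _ Bmx]; have [_ _] := SP n m; move=> /(_ x (Anx m I)).
Qed.

Lemma borel_separatedS A B A' B' : A `<=` A' -> B `<=` B' ->
  borel_separated A' B' -> borel_separated A B.
Proof.
move=> AA BB [S bS [AS SB]]; exists S => //; split; first exact: subset_trans AS.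
by apply: subset_trans SB _; exact: subsetC.
Qed.

(** If two parametrised sets cannot be separated, then some pair of their
    countably many pieces cannot be either.  Iterating this gives two parameters
    x and y all of whose pairs of initial segments describe inseparable pieces;
    but disjoint open neighbourhoods of f x and g y separate small pieces. *)
Lemma lusin_separation A B : hausdorff_space X ->
  analytic A -> analytic B -> A `<=` ~` B -> borel_separated A B.
Proof.
move=> hX [C [f [cC fc ->]]] [D [g [cD gc ->]]] AB; apply: contrapT => nAB.
have stemS (s : seq nat) : stem s `<=` \bigcup_n stem (rcons s n).
  by move=> x xs; exists (x (size s)) => //; rewrite /stem /= size_rcons mkseqS xs.
have imstem (E : set baire) (h : baire -> X) s :
    h @` (E `&` stem s) `<=` \bigcup_n h @` (E `&` stem (rcons s n)).
  by move=> _ [x [Ex /stemS[n _ xn]] <-]; exists n => //; exists x.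
pose bad (s t : seq nat) :=
  ~ borel_separated (f @` (C `&` stem s)) (g @` (D `&` stem t)).
have badS s t : bad s t -> exists n m, bad (rcons s n) (rcons t m).
  move=> st; apply: contrapT => nst; apply: st.
  apply: borel_separatedS (@imstem C f s) (@imstem D g t) _.
  apply: borel_separated_bigcup => n m; apply: contrapT => h.
  by apply: nst; exists n, m.
pose T := {st : seq nat * seq nat | bad st.1 st.2}.
have bad0 : bad [::] [::].
  move=> sep; apply: nAB; apply: borel_separatedS sep => _ [x ? <-]; exists x => //.
pose r (p q : T) := exists n m,
  (sval q).1 = rcons (sval p).1 n /\ (sval q).2 = rcons (sval p).2 m.
have [|h [h0 hS]] := @dependent_choice_from T r (exist _ ([::], [::]) bad0).
  move=> [[s t] /= st]; have [n [m nm]] := badS s t st.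
  by exists (exist _ (rcons s n, rcons t m) nm), n, m.
have /choice[x /choice[y xyP]] := hS.
have h1 n : (sval (h n)).1 = mkseq x n.
  by elim: n => [|n IH]; rewrite ?h0 // mkseqS -IH; have [] := xyP n.
have h2 n : (sval (h n)).2 = mkseq y n.
  by elim: n => [|n IH]; rewrite ?h0 // mkseqS -IH; have [] := xyP n.
have badxy n : bad (mkseq x n) (mkseq y n) by rewrite -h1 -h2; exact: (svalP (h n)).
have Cx : C x.
  apply: closed_baire => // n; apply: contrapT => h'; apply: (badxy n).
  exists set0; first exact: borel_set0; split=> // _ [w [Cw cw] <-].
  by apply: h'; exists w => //; exact: stem_mkseq.
have Dy : D y.
  apply: closed_baire => // n; apply: contrapT => h'; apply: (badxy n).
  exists setT; first exact: borel_setT; split=> // ? _ [w [Cw cw] _].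
  by apply: h'; exists w => //; exact: stem_mkseq.
have fg : f x <> g y by move=> e; apply: (AB (f x)); [exists x|exists y].
have [U [V [oU oV Ux Vy UV]]] := hausdorff_disjoint_nbhs hX fg.
have /dprod_nbhs[n nU] : nbhs (x : baire) (f @^-1` U).
  by apply: fc; apply: open_nbhs_nbhs.
have /dprod_nbhs[m mV] : nbhs (y : baire) (g @^-1` V).
  by apply: gc; apply: open_nbhs_nbhs.
apply: (badxy (maxn n m)); exists U; first exact: borel_open.
split=> [_ [z [_ cz] <-]|w Uw [z [_ cz] zw]].
  by apply: nU => j jn; apply: (stem_mkseq cz); rewrite leq_max jn.
apply: (UV w) => //; rewrite -zw; apply: mV => j jm.
by apply: (stem_mkseq cz); rewrite leq_max jm orbT.
Qed.

End Separation.

(** * Polish spaces are continuous images of the Baire space *)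

Section Polish.
Local Open Scope ring_scope.
Variables (R : realType) (P : topologicalType) (d : P -> P -> R).
Hypotheses (dm : is_metric d) (dc : metric_compatible d).

Lemma metric_nbhsP (x : P) (U : set P) :
  nbhs x U <-> exists2 e, 0 < e & forall y, d x y < e -> U y.
Proof.
rewrite dc; split=> [[e /= e0 eU]|[e e0 eU]]; exists e => //.
Qed.

Lemma metric_compatible_hausdorff : hausdorff_space P.
Proof.
have [d0 dE ds dt] := dm.
move=> x y xy; apply/dE; apply/eqP; rewrite eq_le d0 andbT leNgt.
apply/negP => xy0.
have e0 : 0 < d x y / 2 by rewrite divr_gt0.
have [||z [/= xz yz]] := xy [set z | d x z < d x y / 2] [set z | d y z < d x y / 2].
- by apply/metric_nbhsP; exists (d x y / 2).
- by apply/metric_nbhsP; exists (d x y / 2).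
have := dt x z y; rewrite (ds z y); lra.
Qed.

Let eps n : R := 2^-1 ^+ n.

Let eps_gt0 n : 0 < eps n.
Proof. by rewrite exprn_gt0 // invr_gt0. Qed.

Let epsS n : eps n = 2 * eps n.+1.
Proof. by rewrite /eps exprS mulrA divff ?mul1r // pnatr_eq0. Qed.

Let eps_lt e : 0 < e -> exists n, 4 * eps n < e.
Proof.
move=> e0; have := @archi_boundP R (4 / e).
rewrite divr_ge0 ?ltW // => /(_ isT); set n := Num.bound _ => ne.
exists n; move: ne; rewrite /eps exprVn ltr_pdivrMr // ltr_pdivrMr ?exprn_gt0 //.
move=> /lt_trans; apply; rewrite mulrC ltr_pM2l // -natrX ltr_nat.
exact: ltn_expl.
Qed.

(** A sequence x of indices in a dense sequence q is read as instructions: move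
    from the current point to q (x n) when it is within 2^-n, and stay otherwise.
    The moves then always converge, and every point is approached by suitable
    instructions. *)
Lemma complete_metric_suslin (D : set P) :
  countable D -> dense D -> metric_complete d -> P -> suslin P.
Proof.
move=> cD dD dcomp x0; have [d0 dE ds dt] := dm.
have dxx x : d x x = 0 by exact/dE.
have [q qP] : exists q : nat -> P, forall x e, 0 < e -> exists n, d (q n) x < e.
  have [f fi] := countable_injP D cD.
  exists (fun n => xget x0 [set x | D x /\ f x = n]) => x e e0.
  have : nbhs x [set y | d x y < e] by apply/metric_nbhsP; exists e.
  rewrite nbhsE => -[O [oO Ox] sO].
  have [y [Oy Dy]] : O `&` D !=set0 by apply: dD => //; exists x.
  exists (f y); case: xgetP => [z _ [Dz fzy]|/(_ y) []//].
  suff -> : z = y by rewrite ds; exact: sO.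
  by apply: fi; rewrite ?inE.
pose fix u (x : nat -> nat) n : P := if n is m.+1
  then (if d (u x m) (q (x m.+1)) < eps m then q (x m.+1) else u x m)
  else q (x 0%N).
have uS x n : d (u x n) (u x n.+1) <= eps n.
  by rewrite /=; case: ifP => [/ltW//|_]; rewrite dxx ltW.
have uD x n k : d (u x n) (u x (n + k)%N) <= 2 * eps n - 2 * eps (n + k)%N.
  elim: k => [|k IH]; first by rewrite addn0 subrr dxx.
  rewrite addnS; have := dt (u x n) (u x (n + k)%N) (u x (n + k).+1).
  have := uS x (n + k)%N; have := epsS (n + k)%N; lra.
have ud x m n : (m <= n)%N -> d (u x m) (u x n) <= 2 * eps m.
  move=> /subnKC <-; have := uD x m (n - m)%N; have := eps_gt0 (m + (n - m))%N; lra.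
have /choice[p pP] : forall x : baire, exists y : P, u x @ \oo --> y.
  move=> x; apply: dcomp => e /eps_lt[N Ne]; exists N => m n Nm Nn.
  have := dt (u x m) (u x N) (u x n); rewrite (ds _ (u x N)).
  by have := ud x _ _ Nm; have := ud x _ _ Nn; lra.
have up x n : d (u x n) (p x) <= 2 * eps n.
  apply/ler_addgt0Pl => e e0.
  have /(pP x)[N _ NP] : nbhs (p x) [set y | d (p x) y < e].
    by apply/metric_nbhsP; exists e.
  have := NP (maxn N n); rewrite /= leq_max leqnn => /(_ isT).
  have := @ud x n (maxn N n); rewrite leq_max leqnn orbT => /(_ isT).
  by have := dt (u x n) (u x (maxn N n)) (p x); rewrite (ds (p x)); lra.
have uE x y n : (forall j, (j < n.+1)%N -> x j = y j) -> u x n = u y n.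
  elim: n => [|n IH] xy /=; first by rewrite xy.
  by rewrite IH ?xy // => j jn; apply: xy; rewrite ltnS ltnW.
exists p; split=> [x U /metric_nbhsP[e /eps_lt[n ne] eU]|z].
  apply: (@filterS _ _ (@nbhs_filter baire x)) (near_cylinder x n.+1) => y xy.
  apply: eU; have := up x n; have := up y n; rewrite (uE y x n) // => h1 h2.
  by have := dt (p x) (u x n) (p y); rewrite (ds (p x) (u x n)); lra.
have /choice[x xP] : forall n, exists k, d (q k) z < eps n.+1.
  by move=> n; apply: qP.
have ux n : u x n = q (x n).
  elim: n => [//|n IH] /=; rewrite IH; case: ifP => // /negP[].
  have := dt (q (x n)) z (q (x n.+1)); rewrite (ds z (q (x n.+1))).
  have := xP n; have := xP n.+1; have := epsS n; have := epsS n.+1.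
  by have := eps_gt0 n.+2; lra.
exists x; apply/dE/eqP; rewrite eq_le d0 andbT; apply/ler_addgt0Pl => e.
move=> /eps_lt[n ne]; rewrite addr0.
have := dt (p x) (u x n) z; rewrite (ds (p x) (u x n)); have := up x n; rewrite ux.
by have := xP n; have := epsS n; have := eps_gt0 n; lra.
Qed.

End Polish.

(** * Borel linearization of acyclic relations *)

Section Chains.
Variables (X : topologicalType) (le : quasi_order X).
Implicit Types (S B : set (X * X)) (s t : seq (set (X * X))) (u v w : X).

Definition rcomp S B : set (X * X) :=
  [set p | exists2 v, S (p.1, v) & B (v, p.2)].

Definition le_graph : set (X * X) := [set p | le p.1 p.2].

(** The relation le; S1; le; S2; ...; Sn; le.  Keeping le at both ends makes
    concatenation of lists correspond to composition, since le; le = le. *)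
Fixpoint chain s : set (X * X) :=
  if s is A :: t then rcomp le_graph (rcomp A (chain t)) else le_graph.

(** Since le is transitive, consecutive uses of le in a closed walk can be merged,
    so it is enough to exclude walks alternating le with S. *)
Definition acyclic S := forall n u, ~ chain (nseq n.+1 S) (u, u).

Lemma chain_lel s u v w : le u v -> chain s (v, w) -> chain s (u, w).
Proof.
case: s => [|A s] /= uv; first exact: qo_trans.
by move=> [x vx xw]; exists x => //; exact: qo_trans vx.
Qed.

Lemma chain_ler s u v w : chain s (u, v) -> le v w -> chain s (u, w).
Proof.
move=> + vw; elim: s u => [|A s IH] u /=.
  by move=> /(@qo_trans _ le _ _ _)/(_ vw).
by move=> [x ux [y xy /IH]]; exists x => //; exists y.
Qed.

Lemma chain_cat s t u w :
  chain (s ++ t) (u, w) <-> exists2 v, chain s (u, v) & chain t (v, w).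
Proof.
elim: s u => [|A s IH] u /=.
  split=> [|[v uv]]; last exact: chain_lel.
  by exists u => //; exact: qo_refl.
split=> [[x ux [y xy /IH[v yv vw]]]|[v [x ux [y xy yv]] vw]].
  by exists v => //; exists x => //; exists y.
by exists x => //; exists y => //; apply/IH; exists v.
Qed.

(** Cyclic rotation of a closed walk brings any of its steps to the front. *)
Lemma chain_rot s t u : chain (s ++ t) (u, u) ->
  exists v, chain (t ++ s) (v, v).
Proof. by move=> /chain_cat[v uv vu]; exists v; apply/chain_cat; exists u. Qed.

Lemma chain_nseqS n S B : S `<=` B -> chain (nseq n S) `<=` chain (nseq n B).
Proof.
move=> SB; elim: n => [|n IH] //= p [x ux [y xy yv]].
by exists x => //; exists y; [exact: SB|exact: IH].
Qed.

Lemma chain1 S u v : S (u, v) -> chain [:: S] (u, v).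
Proof. by exists u; [exact: qo_refl|exists v => //; exact: qo_refl]. Qed.

Hypotheses (hX : hausdorff_space X) (sX : suslin X) (le_borel : borel_quasi_order le).

Let hXX : hausdorff_space (X * X)%type := hausdorff_prod hX hX.
Let sXX : suslin (X * X)%type := suslin_prod sX sX.

Lemma analytic_rcomp S B : analytic S -> analytic B -> analytic (rcomp S B).
Proof.
move=> [C [f [cC fc ->]]] [D [g [cD gc ->]]].
pose r b : bspace (bool * nat)%type -> baire := fun x m => x (b, m).
have rc b : continuous (r b) by exact: continuous_reindex.
have frc := continuous_o fc (rc true); have grc := continuous_o gc (rc false).
rewrite (_ : rcomp _ _ = (fun x => ((f (r true x)).1, (g (r false x)).2)) @`
  (r true @^-1` C `&` r false @^-1` D `&`
   [set x | (f (r true x)).2 = (g (r false x)).1])).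
  apply: analytic_bspace.
    do 2?[apply: closedI]; do 2?[exact: closed_preimage].
    apply: closed_eq => //.
      exact: (continuous_o (@continuous_snd X X) frc).
    exact: (continuous_o (@continuous_fst X X) grc).
  apply: continuous_pair.
    exact: (continuous_o (@continuous_fst X X) frc).
  exact: (continuous_o (@continuous_snd X X) grc).
rewrite eqEsubset; split=> [[u w] [v /= [x Cx fx] [y Dy gy]]|].
  pose z : bspace (bool * nat)%type := fun bn => if bn.1 then x bn.2 else y bn.2.
  have rt : r true z = x by apply: funext.
  have rf : r false z = y by apply: funext.
  by exists z; rewrite /= rt rf fx gy.
move=> _ [z /= [[Cz Dz] e] <-]; exists (f (r true z)).2.
  by exists (r true z) => //=; rewrite -surjective_pairing.
by exists (r false z) => //=; rewrite e -surjective_pairing.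
Qed.

Lemma analytic_le : analytic le_graph.
Proof. exact: analytic_borel. Qed.

Lemma analytic_chain s : (forall S, S \in s -> analytic S) -> analytic (chain s).
Proof.
elim: s => [_|A s IH sa] /=; first exact: analytic_le.
apply: analytic_rcomp; first exact: analytic_le.
apply: analytic_rcomp; first by apply: sa; exact: mem_head.
by apply: IH => B Bs; apply: sa; rewrite in_cons Bs orbT.
Qed.

(** A closed walk through S followed by s is a pair of S whose converse lies in
    the chain of s, so enlarging S without creating one amounts to separating S
    from the converse of that chain. *)
Lemma borel_hull_head S s : analytic S -> analytic (chain s) ->
  (forall u, ~ chain (S :: s) (u, u)) ->
  exists B, [/\ borel_set B, S `<=` B & forall u, ~ chain (B :: s) (u, u)].
Proof.
move=> aS as_ Ss.
have [|B bB [SB BV]] := lusin_separation hXX aS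
    (analytic_image (@swap_continuous X X) as_).
  move=> [x y] Sxy [[u v] uv [vx uy]]; apply: (Ss x).
  exists x; first exact: qo_refl.
  by exists y; rewrite // -uy -vx.
exists B; split=> // u [x ux [y Bxy yu]].
by apply: (BV _ Bxy); exists (y, x) => //; exact: chain_ler yu ux.
Qed.

(** The n occurrences of S are enlarged one after the other: each is rotated to
    the front, and the enlargement replaces the previous ones by a smaller set,
    which is harmless because the condition is antitone. *)
Lemma borel_hull_nseq S n : analytic S ->
  (forall u, ~ chain (nseq n S) (u, u)) ->
  exists B, [/\ borel_set B, S `<=` B & forall u, ~ chain (nseq n B) (u, u)].
Proof.
move=> aS Sn.
suff H i j B : borel_set B -> S `<=` B ->
    (forall u, ~ chain (nseq i S ++ nseq j B) (u, u)) ->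
    exists B, [/\ borel_set B, S `<=` B & forall u, ~ chain (nseq (i + j) B) (u, u)].
  have := H n 0%N setT; rewrite cats0 addn0; apply=> //.
  exact: borel_setT.
elim: i j B => [|i IH] j B bB SB ij; first by exists B.
have [|B' [bB' SB' B'ij]] := @borel_hull_head S (nseq i S ++ nseq j B) aS _ ij.
  apply: analytic_chain => A; rewrite mem_cat => /orP[] /nseqP[-> _] //.
  exact: analytic_borel.
have [||u h|B'' [? ? ?]] := IH j.+1 (B' `&` B).
- exact: borel_setI.
- by move=> p Sp; split; [exact: SB'|exact: SB].
- rewrite -addn1 nseqD catA in h.
  have [v [x vx [y [B'xy _] /chain_cat[w yw wv]]]] := chain_rot h.
  apply: (B'ij v); exists x => //; exists y => //; apply/chain_cat; exists w => //.
  by apply: chain_nseqS wv => p [].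
- by exists B''; rewrite addSnnS.
Qed.

(** The hulls obtained for the separate lengths are intersected. *)
Lemma acyclic_borel_hull S : analytic S -> acyclic S ->
  exists B, [/\ borel_set B, S `<=` B & acyclic B].
Proof.
move=> aS Sac; have /choice[B BP] n := borel_hull_nseq aS (Sac n).
exists (\bigcap_n B n); split.
- by apply: borel_bigcap => n; have [] := BP n.
- by move=> p Sp n _; have [_ + _] := BP n; exact.
- move=> n u h; have [_ _ /(_ u)] := BP n; apply.
  by apply: chain_nseqS h => p; exact.
Qed.

Definition chain_closure S : set (X * X) := \bigcup_n chain (nseq n.+1 S).

Lemma analytic_chain_closure S : analytic S -> analytic (chain_closure S).
Proof.
move=> aS; apply: analytic_bigcup => n; apply: analytic_chain => A.
by move=> /nseqP[->].
Qed.

Lemma chain_nseq_closure S n u v : chain (nseq n (chain_closure S)) (u, v) ->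
  exists2 m, (n <= m)%N & chain (nseq m S) (u, v).
Proof.
elim: n u => [|n IH] u /=; first by exists 0%N.
move=> [x ux [y [k _ xy] /IH[m nm yv]]]; exists (k.+1 + m)%N.
  by rewrite addSn ltnS (leq_trans nm) ?leq_addl.
by rewrite nseqD; apply/chain_cat; exists y => //; exact: chain_lel xy.
Qed.

Lemma acyclic_chain_closure S : acyclic S -> acyclic (chain_closure S).
Proof. by move=> Sac n u /chain_nseq_closure[[//|m] _]; exact: Sac. Qed.

(** A Borel hull of S need not be closed under chains, and the closure of a
    Borel set under chains is only analytic.  Alternating both operations gives
    an increasing sequence whose union U is at once Borel, transitive, stable
    under le on both sides and, being acyclic, irreflexive; le \/ U is the
    extension. *)
Lemma acyclic_borel_extension S : analytic S -> acyclic S ->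
  exists le' : quasi_order X, [/\ borel_quasi_order le',
    qo_equiv le' =2 qo_equiv le, subrel le le' & forall p, S p -> qo_lt le' p.1 p.2].
Proof.
move=> aS Sac.
pose T := {B : set (X * X) | borel_set B /\ acyclic B}.
have hullT B : analytic B -> acyclic B -> exists B' : T, B `<=` sval B'.
  move=> aB /(acyclic_borel_hull aB)[B' [bB' BB' aB']].
  by exists (exist _ B' (conj bB' aB')).
have [B0 SB0] := hullT S aS Sac.
have [|B [B_0 BS]] :=
    @dependent_choice_from T (fun B B' : T => chain_closure (sval B) `<=` sval B') B0.
  move=> [B [bB aB]]; apply: hullT; last exact: acyclic_chain_closure.
  exact/analytic_chain_closure/analytic_borel.
have subcl A : A `<=` chain_closure A by move=> [u v] uv; exists 0%N => //; exact: chain1.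
have Bmono m n : (m <= n)%N -> sval (B m) `<=` sval (B n).
  move=> /subnKC <-; elim: (n - m)%N => [|k IH]; first by rewrite addn0.
  by rewrite addnS => p /IH /subcl; exact: BS.
pose U := \bigcup_n sval (B n).
have bU : borel_set U by apply: borel_bigcup => n; have [] := svalP (B n).
have Ulel u v w : le u v -> U (v, w) -> U (u, w).
  move=> uv [n _ vw]; exists n.+1 => //; apply: BS; exists 0%N => //.
  by apply: chain_lel uv _; exact: chain1.
have Uler u v w : U (u, v) -> le v w -> U (u, w).
  move=> [n _ uv] vw; exists n.+1 => //; apply: BS; exists 0%N => //.
  by apply: chain_ler vw; exact: chain1.
have Utrans u v w : U (u, v) -> U (v, w) -> U (u, w).
  move=> [n _ uv] [m _ vw]; exists (maxn n m).+1 => //; apply: BS; exists 1%N => //.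
  apply: (chain_cat [:: _] [:: _] u w).2; exists v; apply: chain1.
    by apply: Bmono uv; rewrite leq_maxl.
  by apply: Bmono vw; rewrite leq_maxr.
have Uirr u : ~ U (u, u).
  by move=> [n _ uu]; have [_ /(_ 0%N u)] := svalP (B n); apply; exact: chain1.
pose r : rel X := fun x y => le x y || `[< U (x, y) >].
have r_refl : reflexive r by move=> x; rewrite /r qo_refl.
have r_trans : transitive r.
  move=> y x z /orP[xy|/asboolP xy] /orP[yz|/asboolP yz]; apply/orP.
  - by left; exact: qo_trans xy yz.
  - by right; apply/asboolP; exact: Ulel xy yz.
  - by right; apply/asboolP; exact: Uler xy yz.
  - by right; apply/asboolP; exact: Utrans xy yz.
exists (QuasiOrder r_refl r_trans); split => /=.
- rewrite /borel_quasi_order (_ : [set _ | _] = le_graph `|` U) /=.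
    exact: borel_setU.
  rewrite eqEsubset; split=> [[x y] /= /orP[|/asboolP]|[x y] []]; rewrite /r /=.
  + by left.
  + by right.
  + by move=> h; apply/orP; left.
  + by move=> h; apply/orP; right; apply/asboolP.
- move=> x y; rewrite /qo_equiv /= /r; apply/andP/andP => -[]; last first.
    by move=> -> ->.
  move=> /orP[xy|/asboolP xy] /orP[yx|/asboolP yx] //.
  + by case: (Uirr x); exact: Ulel xy yx.
  + by case: (Uirr x); exact: Uler xy yx.
  + by case: (Uirr x); exact: Utrans xy yx.
- by move=> x y xy; rewrite /r xy.
- move=> [x y] Sxy; have Uxy : U (x, y) by exists 0%N => //; rewrite B_0; exact: SB0.
  rewrite /qo_lt /= /r; apply/andP; split; first by apply/orP; right; apply/asboolP.
  apply/negP => /orP[yx|/asboolP yx]; apply: (Uirr x).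
    exact: Uler Uxy yx.
  exact: Utrans Uxy yx.
Qed.

End Chains.

(** * Countable Borel order dimension *)

Section Odim.
Variables (P : topologicalType) (le : quasi_order P).

Lemma odimB_witness_surj (K L : Type) (g : L -> K) :
  (forall k, exists l, g l = k) -> odimB_witness le K -> odimB_witness le L.
Proof.
move=> gs [lt_ [ltB cov]]; exists (fun l => lt_ (g l)); split=> [l|x y].
  exact: ltB.
by have [k] := cov x y; have [l <-] := gs k; exists l.
Qed.

(** The minimal cardinal is the least n that indexes a witnessing family, or
    aleph_0 if only infinite sets do. *)
Lemma odimB_le_aleph0_witness : odimB_witness le nat -> odimB_le_aleph0 le.
Proof.
move=> wN.
have finw (K : Type) : finite_set [set: K] -> odimB_witness le K ->
    exists2 n, odimB_witness le `I_n & [set: K] #= `I_n.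
  move=> /finite_setP[n Kn] wK; exists n => //.
  have /card_bijP[f [g fg gf]] := Kn.
  apply: (odimB_witness_surj (g := fun i => val (g i))) wK => k.
  have kT : k \in [set: K] by rewrite inE.
  by exists (f (SigSub kT)); rewrite fg.
have [[n wn]|nfin] := pselect (exists n, odimB_witness le `I_n).
  have exn : exists m, `[< odimB_witness le `I_m >] by exists n; apply/asboolP.
  exists `I_(ex_minn exn); case: ex_minnP => m /asboolP wm m_min; split; last first.
    by rewrite (card_le_eql (card_setT _)); exact: card_leT.
  split=> // K wK; rewrite (card_le_eql (card_setT _)).
  have [/finw/(_ wK)[k wk Kk]|infK] := pselect (finite_set [set: K]).
    by rewrite (card_le_eqr Kk) card_le_II; apply: m_min; apply/asboolP.
  by apply: card_le_trans (card_leT _) _; apply/infiniteP.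
exists nat; split=> //; split=> // K wK; apply/infiniteP => /finw/(_ wK)[n wn _].
by apply: nfin; exists n.
Qed.

Lemma qo_lt_repr (le' : quasi_order P) : qo_equiv le' =2 qo_equiv le ->
  forall x y, qo_lt le' (repr (qo_class le x)) (repr (qo_class le y)) = qo_lt le' x y.
Proof.
move=> ee x y.
have cr z : qo_equiv le' (repr (qo_class le z)) z.
  rewrite ee; have := reprK (qo_class le z).
  by rewrite {2}/qo_class => /(@eqmodP _ (qo_equiv_rel le)).
rewrite /qo_lt; case/andP: (cr x) => ax xa; case/andP: (cr y) => ay ya.
congr (_ && ~~ _); apply/idP/idP => h.
- exact: qo_trans xa (qo_trans h ay).
- exact: qo_trans ax (qo_trans h ya).
- exact: qo_trans ya (qo_trans h ax).
- exact: qo_trans ay (qo_trans h xa).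
Qed.

Definition borel_extension (le' : quasi_order P) :=
  [/\ borel_quasi_order le', qo_equiv le' =2 qo_equiv le & subrel (qo_lt le) (qo_lt le')].

(** Pairs that are comparable are handled by any extension, so only the
    incomparable ones matter. *)
Lemma odimB_le_aleph0P : borel_quasi_order le ->
  odimB_le_aleph0 le <->
  exists le_ : nat -> quasi_order P, (forall n, borel_extension (le_ n)) /\
    forall x y, incomparable le x y -> exists n, qo_lt (le_ n) y x.
Proof.
move=> ble; split=> [[K [[[lt_ [ltP cov] _]]] cK]|[le_ [leP cov]]].
  have /choice[g gP] : forall k, exists le', borel_extension le' /\
      forall x y, lt_ k (qo_class le x) (qo_class le y) = qo_lt le' x y.
    move=> k; have [[_ [le' [ble' ee lt']]] sub] := ltP k.
    exists le'; split=> //; split=> // x y xy.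
    by rewrite -lt'; apply: sub; rewrite quot_ltE.
  have [f fi] := countable_injP _ cK.
  have /choice[h hP] : forall n, exists le', borel_extension le' /\
      forall k, f k = n -> le' = g k.
    move=> n; have [[k fk]|nk] := pselect (exists k, f k = n).
      exists (g k); split; first by have [] := gP k.
      by move=> k' fk'; congr g; apply: fi; rewrite ?inE // fk.
    exists le; split; last by move=> k fk; case: nk; exists k.
      by split.
  exists h; split=> [n|x y xy]; first by have [] := hP n.
  have [k] := cov x y.
  have [_ gk] := gP k; have [_ hk] := hP (f k).
  rewrite gk quot_ltE => -[yx|/andP[]|].
  - by exists (f k); rewrite (hk k).
  - by case/andP: xy => /negP.
  - move=> /(@eqmodP _ (qo_equiv_rel le)) /andP[]; by case/andP: xy => /negP.
apply: odimB_le_aleph0_witness.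
exists (fun n a b => qo_lt (le_ n) (repr a) (repr b)); split=> [n|x y].
  have [ble_ ee sub] := leP n; split; last by move=> a b; exact: sub.
  split; first split.
  - by move=> a; rewrite /qo_lt qo_refl.
  - move=> b a c /andP[ab nba] /andP[bc ncb]; rewrite /qo_lt (qo_trans ab bc) /=.
    by apply: contra nba => ca; exact: qo_trans bc ca.
  - by exists (le_ n); split=> // x y; exact: qo_lt_repr.
have qo n u v : qo_lt (le_ n) (repr (qo_class le u)) (repr (qo_class le v)) =
    qo_lt (le_ n) u v by apply: qo_lt_repr; have [] := leP n.
have [xy|nxy] := boolP (le x y); have [yx|nyx] := boolP (le y x).
- exists 0%N; apply: Or33; apply/eqmodP; rewrite /= /qo_equiv.
  by rewrite xy yx.
- by exists 0%N; apply: Or32; rewrite quot_ltE /qo_lt xy.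
- exists 0%N; apply: Or31; rewrite qo; have [_ _] := leP 0%N; apply.
  by rewrite /qo_lt yx.
- have [|n yx] := cov x y; first by rewrite /incomparable nxy.
  by exists n; apply: Or31; rewrite qo.
Qed.

End Odim.

(** * Baire category on the branches of a finitely branching tree *)

Section BaireCategory.
Variable f : nat -> nat.
Notation T := (dprod (fun k => 'I_(f k))).
Implicit Types (x y z w : T) (A M : set T).

Definition agree n x y := forall j, (j < n)%N -> x j = y j.

Definition cyl x n : set T := [set w | agree n x w].

(** Cylinders are written as a point together with the length of an initial
    segment of it, which suits a dependent product. *)
Definition nowhere_dense A := forall y m, exists z n,
  [/\ (m <= n)%N, agree m y z & cyl z n `<=` ~` A].

Definition meager A := exists F : nat -> set T,
  (forall n, nowhere_dense (F n)) /\ A `<=` \bigcup_n F n.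

Lemma agree_trans n x y z : agree n x y -> agree n y z -> agree n x z.
Proof. by move=> xy yz j jn; rewrite xy ?yz. Qed.

Lemma agree_leq m n x y : (m <= n)%N -> agree n x y -> agree m x y.
Proof. by move=> mn xy j jm; apply: xy; exact: leq_trans mn. Qed.

Lemma agree_sym n x y : agree n x y -> agree n y x.
Proof. by move=> xy j /xy. Qed.

Lemma nowhere_dense0 : nowhere_dense set0.
Proof. by move=> y m; exists y, m; split=> // w _ []. Qed.

Lemma nowhere_dense_meager A : nowhere_dense A -> meager A.
Proof. by move=> nA; exists (fun=> A); split=> // x Ax; exists 0%N. Qed.

Lemma meagerS A M : A `<=` M -> meager M -> meager A.
Proof. by move=> AM [F [nF MF]]; exists F; split=> //; exact: subset_trans MF. Qed.

Lemma meager_bigcup (M : nat -> set T) :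
  (forall n, meager (M n)) -> meager (\bigcup_n M n).
Proof.
move=> /choice[F FP].
exists (fun k => if (unpickle k : option (nat * nat)) is Some (n, i)
  then F n i else set0); split.
  move=> k; case: unpickle => [[n i]|]; last exact: nowhere_dense0.
  by  have [] := FP n.
move=> x [n _ Mx]; have [_ /(_ x Mx)[i _ Fx]] := FP n.
by exists (pickle (n, i)); rewrite // pickleK.
Qed.

Lemma meagerU A M : meager A -> meager M -> meager (A `|` M).
Proof.
move=> mA mM; apply: (@meagerS _ (\bigcup_n (if n is 0%N then A else M))).
  by move=> x [Ax|Mx]; [exists 0%N|exists 1%N].
by apply: meager_bigcup => -[].
Qed.

Lemma baire_category y m : ~ meager (cyl y m).
Proof.
move=> [F [nF cF]].
pose r (p q : nat * (T * nat)) := [/\ q.1 = p.1.+1, (p.2.2 < q.2.2)%N,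
  agree p.2.2 p.2.1 q.2.1 & cyl q.2.1 q.2.2 `<=` ~` F p.1].
have [|h [h0 hS]] := @dependent_choice_from _ r (0%N, (y, m)).
  move=> [k [z n]]; have [w [i [ni zw wi]]] := nF k z n.+1.
  by exists (k.+1, (w, i)); split=> //=; exact: agree_leq zw.
have hk k : (h k).1 = k.
  by elim: k => [|k IH]; rewrite ?h0 //; have [-> _ _ _] := hS k; rewrite IH.
pose z k := (h k).2.1; pose n k := (h k).2.2.
have nk k : (k <= n k)%N.
  by elim: k => // k IH; have [_ h1 _ _] := hS k; exact: leq_ltn_trans h1.
have nle k i : (n k <= n (k + i)%N)%N.
  elim: i => [|i IH]; first by rewrite addn0.
  by rewrite addnS; have [_ h1 _ _] := hS (k + i)%N; apply: leq_trans IH (ltnW h1).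
have zz k i : agree (n k) (z k) (z (k + i)%N).
  elim: i => [|i IH]; first by rewrite addn0.
  rewrite addnS; have [_ _ h1 _] := hS (k + i)%N; apply: agree_trans IH _.
  exact: agree_leq (nle k i) h1.
pose w : T := fun j => z j.+1 j.
have zw k : agree (n k) (z k) w.
  move=> j jk; rewrite /w; have [kj|jk'] := leqP k j.+1.
    by rewrite -(subnKC kj); exact: (zz k _ j jk).
  by rewrite -(subnKC (ltnW jk')); apply/esym/(zz j.+1 _ j); exact: nk.
have [|k _ Fw] := cF w; first by have := zw 0%N; rewrite /z /n h0.
have [_ _ _] := hS k; rewrite hk => /(_ w); apply => //.
exact: zw.
Qed.

Lemma mkseq_agree n x y : mkseq (@Tseq f x) n = mkseq (@Tseq f y) n -> agree n x y.
Proof.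
move=> xy j jn; apply: ord_inj; have := congr1 (nth 0%N ^~ j) xy.
by rewrite /= !nth_mkseq.
Qed.

Lemma agree_mkseq n x y : agree n x y -> mkseq (@Tseq f x) n = mkseq (@Tseq f y) n.
Proof.
move=> xy; apply/eq_in_map => j; rewrite mem_iota add0n => /xy.
by rewrite /Tseq => ->.
Qed.

(** Split the set into the part inside the countably many cylinders on which A is
    meager, and the rest, which is nowhere dense by assumption.  Cylinders are
    indexed here by finite sequences, to count them. *)
Lemma locally_meager A y m :
  (forall z n, agree m y z -> (m <= n)%N -> exists z' n',
     [/\ (n <= n')%N, agree n z z' & meager (cyl z' n' `&` A)]) ->
  meager (cyl y m `&` A).
Proof.
move=> loc; pose N (s : seq nat) : set T := [set w | mkseq (@Tseq f w) (size s) = s].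
pose G k : set T := if (unpickle k : option (seq nat)) is Some s then
  (if `[< meager (N s `&` A) >] then N s `&` A else set0) else set0.
have m0 : meager set0 by apply: nowhere_dense_meager; exact: nowhere_dense0.
(* Points of the cylinder that no meager piece contains. *)
pose D : set T := [set w | agree m y w /\ forall s, N s w -> ~ meager (N s `&` A)].
apply: (@meagerS _ ((\bigcup_k G k) `|` D)).
  move=> w [yw Aw].
  have [[s [Nw ms]]|ns] := pselect (exists s, N s w /\ meager (N s `&` A)).
    left; exists (pickle s) => //; rewrite /G pickleK.
    by case: asboolP.
  by right; split=> // s Nw ms; apply: ns; exists s.
apply: meagerU.
  apply: meager_bigcup => k; rewrite /G; case: unpickle => [s|//].
  by case: asboolP.
apply: nowhere_dense_meager => z n.
have [yz|nyz] := pselect (agree m y z); last first.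
  exists z, (maxn m n); split=> [||w zw [yw _]]; rewrite ?leq_maxr //.
  apply: nyz; apply: agree_trans yw _; apply: agree_sym.
  by apply: agree_leq zw; rewrite leq_maxl.
have [|z' [n' [nn' zz' mz']]] := loc z (maxn m n) yz; first exact: leq_maxl.
exists z', n'; split.
- by apply: leq_trans nn'; exact: leq_maxr.
- by apply: agree_leq zz'; exact: leq_maxr.
- move=> w zw [_ /(_ (mkseq (@Tseq f z') n'))]; apply.
    by rewrite /N /= size_mkseq; exact/esym/agree_mkseq.
  apply: meagerS mz' => v [Nv Av]; split=> //; move: Nv.
  by rewrite /N /= size_mkseq => /esym /mkseq_agree.
Qed.

(** A form of the Baire property that is visibly stable under complements. *)
Definition locally_decided A := forall y m, exists z n,
  [/\ (m <= n)%N, agree m y z &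
      meager (cyl z n `&` A) \/ meager (cyl z n `&` ~` A)].

(** For a union, if some member is comeager on a smaller cylinder, so is the union;
    otherwise every member is meager on densely many smaller cylinders, hence
    meager, and so is the union. *)
Lemma borel_locally_decided A : borel_set A -> locally_decided A.
Proof.
have m0 : meager set0 by apply: nowhere_dense_meager; exact: nowhere_dense0.
move: A; apply: borel_ind => [U oU y m|A dA y m|A dA y m].
- have [[w [yw Uw]]|nU] := pselect (exists w, cyl y m w /\ U w).
    have /dprod_nbhs[n nU] : nbhs w U by apply: open_nbhs_nbhs.
    exists w, (maxn m n); split=> //; first exact: leq_maxl.
    right; apply: meagerS m0 => v [wv]; apply; apply: nU => j jn; apply/esym/wv.
    by rewrite leq_max jn orbT.
  by exists y, m; split=> //; left; apply: meagerS m0 => v [yv Uv]; apply: nU; exists v.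
- have [z [n [mn yz zA]]] := dA y m; exists z, n; split=> //.
  by rewrite setCK; case: zA; [right|left].
- have [[k [z [n [mn yz mz]]]]|nk] := pselect (exists k z n,
      [/\ (m <= n)%N, agree m y z & meager (cyl z n `&` ~` A k)]).
    exists z, n; split=> //; right; apply: meagerS mz => w [zw nw]; split=> // Aw.
    by apply: nw; exists k.
  exists y, m; split=> //; left; rewrite setI_bigcupr; apply: meager_bigcup => k.
  apply: locally_meager => z n yz mn; have [z' [n' [nn' zz' [?|zA]]]] := dA k z n.
    by exists z', n'.
  case: nk; exists k, z', n'; split=> //; first exact: leq_trans nn'.
  by apply: agree_trans yz _; exact: agree_leq zz'.
Qed.

Lemma comeager_somewhere (A : nat -> set T) y : (forall n, borel_set (A n)) ->
  (forall x, exists n, A n x) -> exists k z n, meager (cyl z n `&` ~` A k).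
Proof.
move=> bA cov; apply: contrapT => nk; apply: (@baire_category y 0%N).
apply: (@meagerS _ (\bigcup_k (cyl y 0%N `&` A k))).
  by move=> w yw; have [k Akw] := cov w; exists k.
apply: meager_bigcup => k; apply: locally_meager => z n _ _.
have [z' [n' [nn' zz' [?|zA]]]] := borel_locally_decided (bA k) z n.
  by exists z', n'.
by case: nk; exists k, z', n'.
Qed.

(** Replacing coordinate l by a constant maps cylinders of length above l onto
    cylinders of the slice, so the cylinders avoiding A in the slice pull back. *)
Lemma nowhere_dense_dfwith l (c : 'I_(f l)) A :
  nowhere_dense A -> nowhere_dense [set w : T | A (dfwith w l c)].
Proof.
move=> nA y m; have [z [n [mn yz zn]]] := nA (dfwith y l c) (maxn m l.+1).
have zl : z l = c by rewrite -yz ?dfwithin // leq_max ltnSn orbT.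
exists (dfwith z l (y l)), n; split.
- by apply: leq_trans mn; exact: leq_maxl.
- move=> j jm; have [<-|lj] := eqVneq l j; first by rewrite dfwithin.
  by rewrite dfwithout // -yz ?dfwithout // leq_max jm.
- move=> w zw; apply: zn => j jn; have [<-|lj] := eqVneq l j.
    by rewrite dfwithin.
  by rewrite dfwithout // -zw // dfwithout.
Qed.

Lemma meager_dfwith l (c : 'I_(f l)) A :
  meager A -> meager [set w : T | A (dfwith w l c)].
Proof.
move=> [F [nF AF]]; exists (fun n => [set w : T | F n (dfwith w l c)]); split.
  by move=> n; exact: nowhere_dense_dfwith.
by move=> w /AF[n _ Fn]; exists n.
Qed.

End BaireCategory.

(** * Countable dimension excludes maps from dense graphs *)

(** At length 2 ^ p * 3 ^ q the selector aims at the finite sequence with code p: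
    each sequence is thus aimed at on arbitrarily large lengths. *)
Definition dense_selector (s : seq nat) : seq nat :=
  let t := odflt [::] (unpickle (logn 2 (size s)) : option (seq nat)) in
  mkseq (fun j => if (nth 0 t j < nth 0 s j)%N then nth 0%N t j else 0%N) (size s).

Lemma dense_selectorP : selector dense_selector.
Proof.
move=> s Fs; split=> [|k ks]; first by rewrite size_mkseq.
rewrite nth_mkseq //; case: ifP => // _.
by have := Fs k ks; case: (nth 0%N s k).
Qed.

Lemma dense_selector_dense f (t : seq nat) :
  (forall j, (j < size t)%N -> (nth 0%N t j < f j)%N) ->
  exists2 l, (size t <= l)%N & forall j, (j < size t)%N ->
    nth 0%N (dense_selector (mkseq f l)) j = nth 0%N t j.
Proof.
move=> tf; pose l := (2 ^ pickle t * 3 ^ size t)%N.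
have tl : (size t <= l)%N.
  apply: leq_trans (ltnW (ltn_expl (size t) (isT : (1 < 3)%N))) _.
  by rewrite leq_pmull // expn_gt0.
exists l => // j jt; have jl := leq_trans jt tl.
rewrite /dense_selector size_mkseq nth_mkseq // nth_mkseq //.
have -> : logn 2 l = pickle t.
  by rewrite lognM ?expn_gt0 // !lognX !logn_prime //= muln1 muln0 addn0.
by rewrite pickleK /= tf.
Qed.

Section Cycles.
Variables (E : seq nat -> seq nat) (f : nat -> nat).
Notation T := (dprod (fun k => 'I_(f k))).

Lemma G0_edge_dfwith l (w : T) (c d : 'I_(f l)) :
  size (E (restrict_seq f l)) = l ->
  (forall j, (j < l)%N -> nth 0%N (E (restrict_seq f l)) j = @Tseq f w j) ->
  nat_of_ord d = (c.+1 %% f l)%N ->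
  @G0_edge E f (dfwith w l c) (dfwith w l d).
Proof.
move=> sE wE dc; exists l, (fun i => @Tseq f w (l.+1 + i)%N).
have Tl (b : 'I_(f l)) : @Tseq f (dfwith w l b) l = b by rewrite /Tseq dfwithin.
have TE (b : 'I_(f l)) : @Tseq f (dfwith w l b) = cat_stream
    (E (restrict_seq f l) ++ [:: @Tseq f (dfwith w l b) l])
    (fun i => @Tseq f w (l.+1 + i)%N).
  apply: funext => j; rewrite Tl /cat_stream size_cat sE /= addn1 nth_cat sE.
  have [jl|lj|->] := ltngtP j l.
  - by rewrite ltnS ltnW // wE // /Tseq dfwithout // neq_ltn jl orbT.
  - by rewrite ltnS leqNgt lj /= subnKC // /Tseq dfwithout // neq_ltn lj.
  - by rewrite ltnSn subnn /= Tl.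
by split; [rewrite !Tl|exact: TE|exact: TE].
Qed.

End Cycles.

Section Incompatibility.
Variables (P : topologicalType) (le : quasi_order P).

Lemma borel_extension_sub (le' : quasi_order P) :
  borel_extension le le' -> subrel le le'.
Proof.
move=> [_ ee sub] x y xy; have [yx|nyx] := boolP (le y x).
  by have := ee x y; rewrite /qo_equiv xy yx => /andP[].
by have /andP[] : qo_lt le' x y by apply: sub; rewrite /qo_lt xy.
Qed.

Lemma qo_lt_le_trans (le' : quasi_order P) x y z :
  le' x y -> qo_lt le' y z -> qo_lt le' x z.
Proof.
move=> xy /andP[yz nzy]; rewrite /qo_lt (qo_trans xy yz) /=.
by apply: contra nzy => zx; exact: qo_trans zx xy.
Qed.

Lemma borel_qo_lt (le' : quasi_order P) : borel_quasi_order le' ->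
  borel_set [set p : P * P | qo_lt le' p.1 p.2].
Proof.
move=> b; have sb := borel_converse b.
rewrite (_ : [set _ | _] = [set p | le' p.1 p.2] `&`
  ~` [set p | le' p.2 p.1]).
  by apply: borel_setI => //; exact: borel_setC.
rewrite eqEsubset; split=> [[x y] /= /andP[? /negP ?]|[x y] [/= ? /negP ?]] //.
by rewrite /qo_lt; apply/andP.
Qed.

(** The elements phi(0, w_c), for the f(l) branches w_c that differ only at
    coordinate l, satisfy phi(0, w_c) <= phi(1, w_{c+1}) by the edges of the graph
    and phi(1, w_{c+1}) < phi(0, w_{c+1}) in the i-th extension: they are strictly
    increasing around a cycle. *)
Lemma countable_odim_no_dense_map : borel_quasi_order le ->
  odimB_le_aleph0 le -> ~ G0_map le dense_selector.
Proof.
move=> ble /(odimB_le_aleph0P ble)[le_ [leP cov]] [f [Ff [phi [cphi hom inc]]]].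
pose T : topologicalType := dprod (fun k => 'I_(f k)).
have {}cphi : continuous (phi : bool * T -> P) by exact: cphi.
have cphib b : continuous (fun x : T => phi (b, x)).
  apply: (continuous_o cphi); apply: continuous_pair; first exact: cst_continuous.
  by move=> x; exact: cvg_id.
pose A i : set T := [set x | qo_lt (le_ i) (phi (true, x)) (phi (false, x))].
have bA i : borel_set (A i).
  have [b _ _] := leP i.
  exact: borel_preimage (continuous_pair (cphib true) (cphib false)) (borel_qo_lt b).
have covA x : exists i, A i x by apply: cov; exact: inc.
have f0 k : (0 < f k)%N by exact: leq_trans (Ff k).
have [i [z [n mz]]] :=
  comeager_somewhere (fun k => Ordinal (f0 k) : discrete_topology 'I_(f k)) bA covA.
have [|l] := @dense_selector_dense f (mkseq (@Tseq f z) n).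
  by move=> j; rewrite size_mkseq => jn; rewrite nth_mkseq //; exact: ltn_ord.
rewrite size_mkseq => nl El.
have [sE Elt] : Tfin (mkseq f l) (dense_selector (mkseq f l)).
  by apply: dense_selectorP => k; rewrite size_mkseq => kl; rewrite nth_mkseq //; exact: Ff.
rewrite size_mkseq in sE Elt.
(* Any branch through the selected node of level l. *)
pose y : T := fun j => insubd (Ordinal (f0 j)) (nth 0%N (dense_selector (mkseq f l)) j).
have yE j : (j < l)%N -> @Tseq f y j = nth 0%N (dense_selector (mkseq f l)) j.
  by move=> jl; rewrite /Tseq /y val_insubd; have := Elt j jl; rewrite nth_mkseq // => ->.
have [w [yw wA]] : exists w, cyl y l w /\ forall c : 'I_(f l), A i (dfwith w l c).
  apply: contrapT => nw; apply: (@baire_category f y l).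
  pose M k : set T := if insub k is Some c then
    [set w : T | (cyl z n `&` ~` A i) (dfwith w l (c : 'I_(f l)))] else set0.
  apply: (@meagerS _ _ (\bigcup_k M k)).
    move=> w yw; apply: contrapT => nM; apply: nw; exists w; split=> // c.
    apply: contrapT => nA; apply: nM; exists c => //; rewrite /M valK /=; split=> // j jn.
    have jl := leq_trans jn nl.
    rewrite dfwithout; last by rewrite neq_ltn jl orbT.
    rewrite -yw //; apply: ord_inj; have := yE j jl; rewrite /Tseq => ->.
    by rewrite El // nth_mkseq.
  apply: meager_bigcup => k; rewrite /M; case: insubP => [c _ _|_].
    exact: meager_dfwith.
  by apply: nowhere_dense_meager; exact: nowhere_dense0.
pose c k : 'I_(f l) := Ordinal (ltn_pmod k (f0 l)).
pose g k := phi (false, dfwith w l (c k) : T).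
have gS k : qo_lt (le_ i) (g k) (g k.+1).
  apply: qo_lt_le_trans (wA (c k.+1)); apply: borel_extension_sub (leP i) _ _ _.
  apply: hom; right; split=> //; apply: G0_edge_dfwith => //.
  - by move=> j jl; rewrite -yE // /Tseq yw.
  - by rewrite /= -addn1 -(addn1 (k %% f l)) modnDml.
have gk k : qo_lt (le_ i) (g 0%N) (g k.+1).
  elim: k => [//|k /andP[IH _]]; exact: qo_lt_le_trans IH (gS _).
have := gk (f l).-1; rewrite prednK // /g (_ : c (f l) = c 0%N).
  by rewrite /qo_lt qo_refl.
by apply: ord_inj; rewrite /= modnn mod0n.
Qed.

End Incompatibility.

(** * The dichotomy *)

Lemma Tfin_rcons (s : seq nat) n v : Tfin (rcons s n) v ->
  exists w i, [/\ v = rcons w i, Tfin s w & (i < n)%N].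
Proof.
case/lastP: v => [|w i]; first by move=> [/=]; rewrite size_rcons.
rewrite /Tfin /= !size_rcons => -[[sz] wi]; exists w, i; split=> //.
  split=> // k ks; have := wi k (leq_trans ks (leqnSn _)).
  by rewrite !nth_rcons sz ks.
by have := wi _ (ltnSn _); rewrite !nth_rcons sz ltnn eqxx.
Qed.

Lemma leq_ubound (g : nat -> nat) n : exists m, forall k, (k < n)%N -> (g k <= m)%N.
Proof.
exists (\max_(k < n) g k) => k kn.
exact: (@leq_bigmax _ (fun k : 'I_n => g k) (Ordinal kn)).
Qed.

Lemma Tfin_ubound (g : seq nat -> nat) s :
  exists m, forall v, Tfin s v -> (g v <= m)%N.
Proof.
elim/last_ind: s g => [|s n IH] g.
  by exists (g [::]) => v [/size0nil -> _].
have /choice[m mP] : forall i, exists m, forall w, Tfin s w -> (g (rcons w i) <= m)%N.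
  by move=> i; exact: IH (fun w => g (rcons w i)).
have [M MP] := leq_ubound m n; exists M => v /Tfin_rcons[w [i [-> sw lin]]].
exact: leq_trans (mP i w sw) (MP i lin).
Qed.

Lemma baire_cvg (u : nat -> baire) (x : baire) :
  (forall k j, (j < k)%N -> u k j = x j) -> u @ \oo --> x.
Proof. by move=> ux; apply: dprod_cvg => j; exists j.+1 => // k; exact: ux. Qed.

Section Cycle.
Variables (P : topologicalType) (le : quasi_order P).

Lemma chain_nseq_cycle (S : set (P * P)) n u v : chain le (nseq n.+1 S) (u, v) ->
  exists q : nat -> P * P, [/\ forall k, (k <= n)%N -> S (q k), le u (q 0%N).1,
    forall k, (k < n)%N -> le (q k).2 (q k.+1).1 & le (q n).2 v].
Proof.
elim: n u => [|n IH] u.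
  by move=> [x ux [y xy yv]]; exists (fun=> (x, y)); split.
move=> [x ux [y xy /IH[q [Sq yq qq qv]]]].
by exists (fun k => if k is k'.+1 then q k' else (x, y)); split=> // -[|k] //=; auto.
Qed.

End Cycle.

Notation slot_index := (nat * seq nat * nat)%type.

Section Dichotomy.
Variables (P : topologicalType) (le : quasi_order P).
Hypotheses (hP : hausdorff_space P) (sP : suslin P) (le_borel : borel_quasi_order le).

Let hPP : hausdorff_space (P * P)%type := hausdorff_prod hP hP.

Variables (C D : set baire) (a b : baire -> P * P).
Hypotheses (cC : closed C) (ac : continuous a)
  (aC : a @` C = [set p | incomparable le p.1 p.2]).
Hypotheses (cD : closed D) (bc : continuous b) (bD : b @` D = le_graph le).

Notation H := (bspace slot_index).

(** A homomorphism from a finite graph, with codes for its values, is a single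
    point psi of a power of the natural numbers.  The sequence in slot 0 at v is a
    code in C of the image of the vertex v, and the sequence in slot k.+1 at v is a
    code in D witnessing the edge that leaves v and was added k levels ago.
    Numbering the edges by age leaves the slots of the next edges free when
    homomorphisms are put together. *)
Definition slot k v (psi : H) : baire := fun j => psi (k, v, j).

Definition vertex v (psi : H) : P * P := a (slot 0 v psi).

(** The part of a homomorphism that lives over the child i of each node at the
    last level, seen as a homomorphism one level below; edges get younger by one
    level, and the edges in slot 1 disappear. *)
Definition branch_index i (t : slot_index) : slot_index :=
  (if t.1.1 is k.+1 then k.+2 else 0%N, rcons t.1.2 i, t.2).

Definition branch i (psi : H) : H := fun t => psi (branch_index i t).

Lemma slot_continuous k v : continuous (slot k v).
Proof. exact: (@continuous_reindex slot_index nat (fun j => (k, v, j))). Qed.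

Lemma vertex_continuous v : continuous (vertex v).
Proof.
by apply: (@continuous_o H baire (P * P)%type (slot 0 v) a);
  [exact: ac|exact: slot_continuous].
Qed.

Lemma branch_continuous i : continuous (branch i).
Proof. exact: (@continuous_reindex slot_index slot_index (branch_index i)). Qed.

(** The sigma-ideal of the sets of homomorphisms that can be discarded. *)
Definition small s (A : set H) := exists (V : nat -> seq nat) (B : nat -> set (P * P)),
  [/\ forall k, Tfin s (V k), forall k, borel_set (B k) /\ acyclic le (B k) &
      A `<=` \bigcup_k (vertex (V k) @^-1` B k)].

Lemma smallS s A A' : A `<=` A' -> small s A' -> small s A.
Proof.
by move=> AA [V [B [? ? ?]]]; exists V, B; split=> //; exact: subset_trans AA _.
Qed.

Lemma small_bigcup s (A : nat -> set H) :
  (forall n, small s (A n)) -> small s (\bigcup_n A n).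
Proof.
move=> /choice[V /choice[B VB]].
pose pr k : nat * nat := odflt (0%N, 0%N) (unpickle k).
exists (fun k => V (pr k).1 (pr k).2), (fun k => B (pr k).1 (pr k).2); split=> [k|k|psi].
- by have [? _ _] := VB (pr k).1.
- by have [_ ? _] := VB (pr k).1.
- move=> [n _ /= An]; have [_ _ /(_ _ An)[i _ Bi]] := VB n.
  by exists (pickle (n, i)) => //; rewrite /pr pickleK.
Qed.

Lemma small_vertex s v B : Tfin s v -> borel_set B -> acyclic le B ->
  small s (vertex v @^-1` B).
Proof. by move=> sv bB aB; exists (fun=> v), (fun=> B); split=> // psi ?; exists 0%N. Qed.

(** The homomorphisms made of n members of A, connected in a cycle through their
    values at u. *)
Definition glue n u (A : set H) : set H := [set psi | forall i, (i < n)%N ->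
  [/\ A (branch i psi), D (slot 1 (rcons u i) psi) &
    b (slot 1 (rcons u i) psi) =
      ((vertex (rcons u i) psi).2, (vertex (rcons u (i.+1 %% n)) psi).1)]].

Lemma analytic_glue n u A : analytic A -> analytic (glue n u A).
Proof.
move=> aA; rewrite (_ : glue n u A = \bigcap_i (if (i < n)%N then
    branch i @^-1` A `&` ((slot 1 (rcons u i) @^-1` D) `&`
    [set psi | b (slot 1 (rcons u i) psi) =
      ((vertex (rcons u i) psi).2, (vertex (rcons u (i.+1 %% n)) psi).1)])
    else setT)); last first.
  rewrite eqEsubset; split=> [psi Apsi i _|psi Apsi i lin].
    by case: ifP => // /Apsi[].
  by have := Apsi i I; rewrite lin => -[? []].
apply: analytic_bigcap => [|i]; first exact: hausdorff_dprod.
case: ifP => _; last first.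
  by apply: analytic_closed; [exact: suslin_bspace|exact: closedT].
apply: analytic_setI; first exact: hausdorff_dprod.
  apply: analytic_preimage => //; first exact: suslin_bspace.
    exact: hausdorff_dprod.
  exact: branch_continuous.
apply: analytic_closed; first exact: suslin_bspace.
apply: closedI.
  by apply: closed_preimage => //; exact: slot_continuous.
apply: closed_eq => //; first by
  apply: (@continuous_o H baire _ (slot 1 (rcons u i)) b); [exact: bc|exact: slot_continuous].
apply: continuous_pair.
  by apply: (@continuous_o H _ _ (vertex (rcons u i)) snd);
    [exact: continuous_snd|exact: vertex_continuous].
by apply: (@continuous_o H _ _ (vertex (rcons u (i.+1 %% n))) fst);
  [exact: continuous_fst|exact: vertex_continuous].
Qed.

(** If all the sets glue n u A are small, let A0 be A without the homomorphisms
    sending a vertex into one of the countably many acyclic Borel sets involved.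
    The values of A0 at u cannot be acyclic, since A0 would be small and A too;
    so they contain a cycle, whose members glue to a homomorphism that avoids all
    the acyclic sets meant to cover it. *)
Lemma glue_large s u A : Tfin s u -> analytic A -> ~ small s A ->
  exists2 n, (2 <= n)%N & ~ small (rcons s n) (glue n u A).
Proof.
move=> su aA nsA; apply: contrapT => nn; apply: nsA.
have /choice[V /choice[B VB]] : forall n, exists (V : nat -> seq nat)
    (B : nat -> set (P * P)), (2 <= n)%N ->
    [/\ forall k, Tfin (rcons s n) (V k), forall k, borel_set (B k) /\ acyclic le (B k) &
      glue n u A `<=` \bigcup_k (vertex (V k) @^-1` B k)].
  move=> n; have [n2|n2] := leqP 2 n; last by exists (fun=> [::]), (fun=> set0).
  have [V [B VB]] : small (rcons s n) (glue n u A).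
    by apply: contrapT => ns; apply: nn; exists n.
  by exists V, B.
pose V' n k := take (size s) (V n k).
pose bad n k : set H := if (2 <= n)%N then vertex (V' n k) @^-1` B n k else set0.
have bad_borel n k : borel_set (bad n k).
  rewrite /bad; case: ifP => [n2|_]; last exact: borel_set0.
  have [_ bB _] := VB n n2; apply: borel_preimage; first exact: vertex_continuous.
  by have [] := bB k.
have bad_small n k : small s (bad n k).
  rewrite /bad; case: ifP => [n2|_]; last first.
    exists (fun=> u), (fun=> set0); split=> // _; split; first exact: borel_set0.
    by move=> m v /= [x _ [y []]].
  have [sV bB _] := VB n n2; have [? ?] := bB k; apply: small_vertex => //.
  rewrite /V'; have [w [i [-> [sw wt] _]]] := Tfin_rcons (sV k).
  by rewrite -sw -cats1 take_size_cat.
pose A0 := A `&` \bigcap_n \bigcap_k ~` bad n k.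
have aA0 : analytic A0.
  apply: analytic_setI => //; first exact: hausdorff_dprod.
  apply: analytic_borel; [exact: suslin_bspace|exact: hausdorff_dprod|].
  by apply: borel_bigcap => n; apply: borel_bigcap => k; exact: borel_setC.
suff sA0 : small s A0.
  apply: (@smallS _ _ (\bigcup_n (if n is m.+1 then \bigcup_k bad m k else A0))).
    move=> psi Apsi; have [A0psi|nA0] := pselect (A0 psi); first by exists 0%N.
    apply: contrapT => nbad; apply: nA0; split=> // n _ k _ bpsi; apply: nbad.
    by exists n.+1 => //; exists k.
  by apply: small_bigcup => -[|n] //; exact: small_bigcup.
pose S := vertex u @` A0.
have aS : analytic S by apply: analytic_image => //; exact: vertex_continuous.
have [Sac|/existsNP[n /existsNP[p /contrapT Sp]]] := pselect (acyclic le S).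
  have [B' [bB' SB' aB']] := acyclic_borel_hull hP sP le_borel aS Sac.
  apply: (smallS _ (small_vertex su bB' aB')) => psi A0psi.
  by apply: SB'; exists psi.
exfalso.
(* Running twice through the cycle guarantees the length at least two that the
   branching numbers of the tree must have. *)
have {}Sp : chain le (nseq (n + n.+1).+1 S) (p, p).
  by rewrite -addSn nseqD; apply/chain_cat; exists p.
set N := (n + n.+1).+1.
have N2 : (2 <= N)%N by rewrite /N addnS.
have [q [Sq pq qq qp]] := chain_nseq_cycle Sp.
have qN k : (k < N)%N -> le (q k).2 (q (k.+1 %% N)).1.
  rewrite ltnS leq_eqVlt => /orP[/eqP->|kN].
    by rewrite modnn; exact: qo_trans qp pq.
  by rewrite modn_small //; exact: qq.
have /choice[phi phiP] : forall k, exists phi, (k < N)%N -> A0 phi /\ vertex u phi = q k.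
  move=> k; have [kN|kN] := leqP N k; first by exists (fun=> 0%N).
  by have [phi ? ?] := Sq k kN; exists phi.
have /choice[e eP] : forall k, exists e, (k < N)%N ->
    D e /\ b e = ((q k).2, (q (k.+1 %% N)).1).
  move=> k; have [kN|/qN kN] := leqP N k; first by exists (fun=> 0%N).
  have : le_graph le ((q k).2, (q (k.+1 %% N)).1) by [].
  by rewrite -bD => -[e De be]; exists e.
(* The last entry of a node says which member of the tuple is used there. *)
pose psi : H := fun t => let i := last 0%N t.1.2 in
  let w := take (size t.1.2).-1 t.1.2 in
  match t.1.1 with
  | 0 => phi i (0%N, w, t.2)
  | 1 => e i t.2
  | k.+2 => phi i (k.+1, w, t.2)
  end.
have tw (w : seq nat) i : take (size (rcons w i)).-1 (rcons w i) = w.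
  by rewrite size_rcons /= -cats1 take_size_cat.
have psi_branch i : branch i psi = phi i.
  apply: funext => -[[[|k] w] j]; rewrite /branch /branch_index /psi /=;
  by rewrite tw last_rcons.
have psi_vertex w i : vertex (rcons w i) psi = vertex w (phi i).
  by rewrite -psi_branch.
have psi_edge i : slot 1 (rcons u i) psi = e i.
  by apply: funext => j; rewrite /slot /psi /= last_rcons.
have [_ _] := VB N N2; move=> /(_ psi)[].
  move=> i iN; rewrite psi_branch psi_edge !psi_vertex.
  have iN' : (i.+1 %% N < N)%N by rewrite ltn_mod.
  have [[Aphi _] ->] := phiP i iN; have [_ ->] := phiP _ iN'.
  by have [De be] := eP i iN.
move=> k _; have [sV _ _] := VB N N2.
have [w [i [Vwi [sw _] iN]]] := Tfin_rcons (sV k).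
rewrite /= Vwi psi_vertex => Bphi.
have [[_ /(_ N I k I) nb] _] := phiP i iN; apply: nb.
by rewrite /bad N2 /V' Vwi -sw -cats1 take_size_cat.
Qed.

Definition digit (psi : H) (n : nat) : nat :=
  if (unpickle n : option slot_index) is Some t then psi t else 0%N.

Lemma digit_pickle psi t : digit psi (pickle t) = psi t.
Proof. by rewrite /digit pickleK. Qed.

(** For each M these sets split the space of homomorphisms into countably many
    pieces, so that a large set meets one of them in a large set. *)
Definition pinned M (c : seq nat) : set H := [set psi | mkseq (digit psi) M = c].

Lemma pinned_eq M c psi psi' t : pinned M c psi -> pinned M c psi' ->
  (pickle t < M)%N -> psi t = psi' t.
Proof.
move=> cp cp' tM; have := congr1 (nth 0%N ^~ (pickle t)) (etrans cp (esym cp')).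
by rewrite /= !nth_mkseq // !digit_pickle.
Qed.

Lemma closed_pinned M c : closed (pinned M c).
Proof.
have [<-|cM] := eqVneq (size c) M; last first.
  rewrite (_ : pinned M c = set0); first exact: closed0.
  rewrite -subset0 => psi cp; move: cM; rewrite -cp /= size_mkseq.
  by rewrite eqxx.
rewrite (_ : pinned (size c) c = \bigcap_n (if (n < size c)%N then
    [set psi | digit psi n = nth 0%N c n] else setT)).
  apply: closed_bigI => n _; case: ifP => _; last exact: closedT.
  rewrite /digit; case: (unpickle n) => [t|] /=.
    rewrite -openC openE => psi /= np; rewrite /interior.
    by apply: filterS (dprod_near psi t) => psi' e; rewrite /= e.
  have [e|ne] := pselect (0%N = nth 0%N c n).
    by rewrite (_ : [set _ | _] = setT); [exact: closedT|rewrite predeqE].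
  by rewrite (_ : [set _ | _] = set0); [exact: closed0|rewrite predeqE].
rewrite eqEsubset; split=> [psi cp n _|psi cp].
  by case: ifP => // nc /=; rewrite -[in RHS]cp nth_mkseq.
apply: (@eq_from_nth _ 0%N); rewrite size_mkseq // => n nc.
by rewrite nth_mkseq //; have := cp n I; rewrite nc.
Qed.

Lemma pinned_large s A M : ~ small s A -> exists c, ~ small s (A `&` pinned M c).
Proof.
move=> nsA; apply: contrapT => /forallNP nc; apply: nsA.
apply: (@smallS _ _ (\bigcup_n (A `&` pinned M (odflt [::] (unpickle n))))).
  move=> psi Apsi.
  exists (pickle (mkseq (digit psi) M)) => //.
  by split=> //; rewrite pickleK.
by apply: small_bigcup => n; apply: contrapT; exact: nc.
Qed.

Definition pinned_up_to m s (A : set H) := forall psi psi', A psi -> A psi' ->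
  forall k v j, (k <= m)%N -> Tfin s v -> (j <= m)%N -> psi (k, v, j) = psi' (k, v, j).

Lemma large_step s u A m : Tfin s u -> analytic A -> ~ small s A ->
  exists n A', [/\ (2 <= n)%N, analytic A', ~ small (rcons s n) A',
    A' `<=` glue n u A & pinned_up_to m (rcons s n) A'].
Proof.
move=> su aA lA; have [n n2 lG] := glue_large su aA lA.
have /choice[g gP] : forall kj : nat * nat, exists M, forall v, Tfin (rcons s n) v ->
    (pickle ((kj.1, v, kj.2) : slot_index) <= M)%N.
  by move=> kj; exact: Tfin_ubound (fun v => pickle ((kj.1, v, kj.2) : slot_index)) _.
have /choice[g' g'P] : forall k, exists M, forall j, (j < m.+1)%N -> (g (k, j) <= M)%N.
  by move=> k; exact: (leq_ubound (fun j => g (k, j))).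
have [M MP] := leq_ubound g' m.+1.
have [c lc] := pinned_large M.+1 lG.
exists n, (glue n u A `&` pinned M.+1 c); split=> //.
- apply: analytic_setI; first exact: hausdorff_dprod.
    exact: analytic_glue.
  by apply: analytic_closed; [exact: suslin_bspace|exact: closed_pinned].
- move=> psi psi' [_ cp] [_ cp'] k v j km sv jm; apply: (pinned_eq cp cp').
  rewrite ltnS; apply: leq_trans (MP k km); apply: leq_trans (g'P k j jm).
  exact: (gP (k, j)).
Qed.

Variable E : seq nat -> seq nat.
Hypothesis selE : selector E.

Let root_homs : set H := slot 0 [::] @^-1` C.

(** The branching numbers f and the large sets are built simultaneously, because
    the cycle lengths are dictated by [glue_large]. *)
Lemma large_sequence : ~ small [::] root_homs ->
  exists f (A : nat -> set H), [/\ Fomega f, A 0%N = root_homs,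
    forall m, A m !=set0,
    forall m, A m.+1 `<=` glue (f m) (E (mkseq f m)) (A m) &
    forall m, pinned_up_to m.+1 (mkseq f m.+1) (A m.+1)].
Proof.
move=> l0.
pose ok (p : seq nat * set H) := [/\ Ffin p.1, analytic p.2 & ~ small p.1 p.2].
pose r (p q : {p | ok p}) := exists n, [/\ (2 <= n)%N, (sval q).1 = rcons (sval p).1 n,
  (sval q).2 `<=` glue n (E (sval p).1) (sval p).2 &
  pinned_up_to (size (sval p).1).+1 (sval q).1 (sval q).2].
have ok0 : ok ([::], root_homs).
  split=> //; apply: analytic_closed; first exact: suslin_bspace.
  by apply: closed_preimage => //; exact: slot_continuous.
have [|h [h0 hS]] := @dependent_choice_from _ r (exist _ _ ok0).
  move=> [[s A] [/= Fs aA lA]].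
  have [n [A' [n2 aA' lA' A'g A'p]]] := large_step (size s).+1 (selE Fs) aA lA.
  have okA' : ok (rcons s n, A').
    split=> //= k; rewrite size_rcons ltnS leq_eqVlt nth_rcons.
    by case: ltngtP => //= ks _; exact: Fs.
  by exists (exist _ _ okA'), n.
have /choice[f fP] := hS.
have hf m : (sval (h m)).1 = mkseq f m.
  by elim: m => [|m IH]; rewrite ?h0 // mkseqS -IH; have [] := fP m.
exists f, (fun m => (sval (h m)).2); split.
- by move=> m; have [] := fP m.
- by rewrite h0.
- move=> m; apply/set0P/negP => /eqP A0; have [Fs _] := svalP (h m); apply.
  rewrite A0; exists (fun=> E (sval (h m)).1), (fun=> set0); split=> // _.
    exact: selE.
  by split; [exact: borel_set0|move=> n v /= [x _ [y []]]].
- by move=> m; rewrite -hf; have [] := fP m.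
- by move=> m; rewrite -hf; have [_ _ _] := fP m; rewrite hf size_mkseq.
Qed.

Section Limit.
Variables (f : nat -> nat) (A : nat -> set H) (psi : nat -> H).
Hypotheses (Ff : Fomega f) (A0E : A 0%N = root_homs) (Apsi : forall m, A m (psi m))
  (Aglue : forall m, A m.+1 `<=` glue (f m) (E (mkseq f m)) (A m))
  (Apin : forall m, pinned_up_to m.+1 (mkseq f m.+1) (A m.+1)).
Notation T := (dprod (fun k => 'I_(f k))).
Implicit Types (x y z : T) (chi : H).

Let pre y m := mkseq (@Tseq f y) m.

Lemma preS y m : pre y m.+1 = rcons (pre y m) (y m : 'I_(f m)).
Proof. exact: mkseqS. Qed.

Lemma Tfin_pre y m : Tfin (mkseq f m) (pre y m).
Proof.
split=> [|k]; rewrite !size_mkseq // => km.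
by rewrite !nth_mkseq //; exact: ltn_ord.
Qed.

Lemma A_branch y m chi : A m.+1 chi -> A m (branch (y m : 'I_(f m)) chi).
Proof. by move=> /Aglue /(_ _ (ltn_ord (y m : 'I_(f m))))[]. Qed.

Lemma A_vertex y m chi : A m chi -> C (slot 0 (pre y m) chi).
Proof.
elim: m chi => [|m IH] chi; first by rewrite A0E.
by move=> /(A_branch y) /IH; rewrite preS.
Qed.

(** The part of a later homomorphism that lies over an initial segment of y
    belongs to the earlier set, where the first digits are fixed. *)
Lemma A_stable y k m d chi j : (k <= m.+1)%N -> (j <= m.+1)%N ->
  A (m.+1 + d)%N chi ->
  slot (if k is k'.+1 then (k + d)%N else 0%N) (pre y (m.+1 + d)) chi j =
  slot k (pre y m.+1) (psi m.+1) j.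
Proof.
move=> km jm; elim: d chi => [|d IH] chi.
  rewrite !addn0 (_ : (if k is _.+1 then k else 0%N) = k); last by case: k {km}.
  by move=> Achi; apply: (Apin Achi) => //; exact: Tfin_pre.
rewrite addnS => /(A_branch y) /IH <-.
by rewrite preS; case: (k) => [|k'] //; rewrite addnS.
Qed.

(** The limit of the codes of the vertices on the branch y, read diagonally. *)
Let code y : baire := fun j => slot 0 (pre y j.+1) (psi j.+1) j.

Lemma code_near y m j : (j < m)%N -> slot 0 (pre y m) (psi m) j = code y j.
Proof.
by move=> /subnKC <-; rewrite (@A_stable y 0 j) // addSn; exact: Apsi.
Qed.

Lemma code_closed y : C (code y).
Proof.
apply: closed_baire => // n; exists (slot 0 (pre y n) (psi n)).
  exact: A_vertex.
by move=> j; exact: code_near.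
Qed.

Lemma code_continuous : continuous (code : T -> baire).
Proof.
apply: continuous_to_dprod => j y.
apply: (@filterS _ _ (@nbhs_filter T y)) (near_cylinder y j.+1) => z zy.
by rewrite /code /pre (@agree_mkseq f j.+1 z y zy).
Qed.

Section Edge.
Variables (y z : T) (l : nat).
Hypotheses (yE : pre y l = E (mkseq f l)) (zE : pre z l = E (mkseq f l))
  (yz : @Tseq f z l = ((@Tseq f y l).+1 %% f l)%N)
  (tail : forall j, (l < j)%N -> y j = z j).

(** The edge was created with age 0 at level l.+1 and has age k at level
    l.+1 + k; appending the same coordinate to both ends preserves it. *)
Lemma A_edge k chi : A (l.+1 + k)%N chi -> D (slot k.+1 (pre y (l.+1 + k)) chi) /\
  b (slot k.+1 (pre y (l.+1 + k)) chi) =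
    ((vertex (pre y (l.+1 + k)) chi).2, (vertex (pre z (l.+1 + k)) chi).1).
Proof.
elim: k chi => [|k IH] chi.
  rewrite addn0 => /Aglue /(_ _ (ltn_ord (y l : 'I_(f l))))[_ Dy by_].
  rewrite !preS yE zE (_ : nat_of_ord (z l : 'I_(f l)) = @Tseq f z l) // yz.
  by split.
rewrite addnS => /(A_branch y) /IH.
by rewrite !preS -(tail (j := (l.+1 + k)%N)) // addSn ltnS leq_addr.
Qed.

(** The witnesses of the edge at the successive levels converge to a point of D,
    which witnesses the edge between the limits. *)
Lemma edge_le : le (a (code y)).2 (a (code z)).1.
Proof.
pose u k := slot k.+1 (pre y (l.+1 + k)) (psi (l.+1 + k)).
pose e : baire := fun j => u j j.
have ue k j : (j < k)%N -> u k j = e j.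
  move=> jk; rewrite /e /u -(subnKC (ltnW jk)) addnA.
  apply: (@A_stable y j.+1 (l + j) (k - j)); last exact: Apsi.
    by rewrite ltnS leq_addl.
  by rewrite (leq_trans (leq_addl l j)).
have De : D e.
  apply: closed_baire => // n; exists (u n); last exact: ue.
  by have [] := A_edge (Apsi (l.+1 + n)).
have bu : b (u k) @[k --> \oo] --> b e.
  by apply: (@cvg_comp _ _ _ u b _ (nbhs e)); [exact: baire_cvg|exact: bc].
have cv x : (a (slot 0 (pre x (l.+1 + k)) (psi (l.+1 + k)))) @[k --> \oo] --> a (code x).
  apply: (@cvg_comp _ _ _ (fun k => slot 0 (pre x (l.+1 + k)) (psi (l.+1 + k))) a _
    (nbhs (code x : baire))); last exact: ac.
  by apply: baire_cvg => k j jk; apply: code_near; rewrite (leq_trans jk) ?leq_addl.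
have bu' : b (u k) @[k --> \oo] --> ((a (code y)).2, (a (code z)).1).
  rewrite (_ : (fun k => b (u k)) = (fun k =>
    ((a (slot 0 (pre y (l.+1 + k)) (psi (l.+1 + k)))).2,
     (a (slot 0 (pre z (l.+1 + k)) (psi (l.+1 + k)))).1))); last first.
    by apply: funext => k; have [_] := A_edge (Apsi (l.+1 + k)).
  apply: cvg_pair.
    exact: (cvg_comp _ _ (cv y) (@continuous_snd P P _)).
  exact: (cvg_comp _ _ (cv z) (@continuous_fst P P _)).
have be : b e = ((a (code y)).2, (a (code z)).1) by exact: cvg_unique bu bu'.
have : le_graph le (b e) by rewrite -bD; exists e.
by rewrite be.
Qed.

End Edge.

Lemma limit_G0_map : G0_map le E.
Proof.
exists f; split=> //.
(* Pairs are coded as (phi(1, y), phi(0, y)). *)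
exists (fun p : bool * T => if p.1 then (a (code p.2)).1 else (a (code p.2)).2).
have cc : continuous (fun y : T => a (code y)).
  by apply: (@continuous_o T baire _ code a); [exact: ac|exact: code_continuous].
have cc2 : continuous (fun p : bool * T => a (code p.2)).
  by apply: (@continuous_o _ T _ snd (fun y => a (code y))) => //; exact: continuous_snd.
have cc21 : continuous (fun p : bool * T => (a (code p.2)).1).
  exact: (continuous_o (@continuous_fst P P) cc2).
have cc22 : continuous (fun p : bool * T => (a (code p.2)).2).
  exact: (continuous_o (@continuous_snd P P) cc2).
split=> [[c y]|y z|y].
- have near_c : \forall p \near (c, y), p.1 = c.
    have := @continuous_fst bool T (c, y) [set c]; apply.
    exact: (@discrete_set1 bool c).
  case: c near_c => near_c; [have := cc21 (true, y)|have := cc22 (false, y)];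
  by apply: cvg_trans; apply: near_eq_cvg; apply: filterS near_c => p ->.
- move=> [//|[_ _ /= [l [x [yz yx zx]]]]].
  have [sE _] : Tfin (mkseq f l) (E (mkseq f l)).
    by apply: selE => k; rewrite size_mkseq => kl; rewrite nth_mkseq.
  rewrite size_mkseq in sE.
  have pref w c : @Tseq f w = cat_stream (E (restrict_seq f l) ++ [:: c]) x ->
      pre w l = E (mkseq f l).
    move=> wx; apply: (@eq_from_nth _ 0%N); rewrite size_mkseq // => j jl.
    by rewrite nth_mkseq // wx /cat_stream size_cat sE addn1 ltnS ltnW // nth_cat sE jl.
  apply: (@edge_le y z l (pref y _ yx) (pref z _ zx) yz) => j lj; apply: ord_inj.
  change (@Tseq f y j = @Tseq f z j); rewrite yx zx /cat_stream !size_cat sE /= addn1.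
  by rewrite ltnS leqNgt lj.
- have : [set p | incomparable le p.1 p.2] (a (code y)).
    by rewrite -aC; exists (code y) => //; exact: code_closed.
  by rewrite /= /incomparable andbC.
Qed.

End Limit.

Lemma G0_dichotomy : small [::] root_homs \/ G0_map le E.
Proof.
have [|ns] := pselect (small [::] root_homs); first by left.
right; have [f [A [Ff A0E Ane Aglue Apin]]] := large_sequence ns.
have /choice[psi Apsi] := Ane.
exact: (limit_G0_map Ff A0E Apsi Aglue Apin).
Qed.

End Dichotomy.

Lemma borel_incomparable (P : topologicalType) (le : quasi_order P) :
  borel_quasi_order le -> borel_set [set p : P * P | incomparable le p.1 p.2].
Proof.
move=> ble.
have sle := borel_converse ble.
rewrite (_ : [set _ | _] = ~` [set p | le p.1 p.2] `&`
  ~` [set p | le p.2 p.1]).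
  by apply: borel_setI; exact: borel_setC.
rewrite eqEsubset; split=> [[x y] /= /andP[/negP ? /negP ?]|[x y] [/= /negP ? /negP ?]] //.
exact/andP.
Qed.

(** When the homomorphisms from the one-point tree form a small set, the
    incomparable pairs are covered by countably many acyclic Borel sets. *)
Lemma not_G0_map_countable_odim (P : topologicalType) (le : quasi_order P)
    (E : seq nat -> seq nat) :
  hausdorff_space P -> suslin P -> borel_quasi_order le -> selector E ->
  ~ G0_map le E -> odimB_le_aleph0 le.
Proof.
move=> hP sP ble selE nG.
have hPP := hausdorff_prod hP hP; have sPP := suslin_prod sP sP.
have [C [a [cC ac /esym aC]]] := analytic_borel sPP hPP (borel_incomparable ble).
have [D [b [cD bc /esym bD]]] := analytic_le hP sP ble.
have [[V [B [V0 BP cov]]]|//] := G0_dichotomy hP sP ble cC ac aC cD bc bD selE.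
have /choice[le_ leP] : forall k, exists le' : quasi_order P,
    [/\ borel_quasi_order le', qo_equiv le' =2 qo_equiv le, subrel le le' &
     forall p, B k p -> qo_lt le' p.1 p.2].
  move=> k; have [bB aB] := BP k; apply: acyclic_borel_extension => //.
  exact: analytic_borel.
apply/(odimB_le_aleph0P ble); exists le_; split=> [n|x y xy].
  have [ble' ee sub _] := leP n; split=> // x y /andP[xy nyx].
  rewrite /qo_lt sub //=; apply: contra nyx => yx.
  by have := ee x y; rewrite /qo_equiv yx sub // => /esym /andP[].
have : [set p | incomparable le p.1 p.2] (y, x) by rewrite /= /incomparable andbC.
rewrite -aC => -[w Cw aw].
pose psi : bspace slot_index := fun t => w t.2.
have [k _] := cov psi Cw; rewrite (_ : V k = [::]); last by have [/size0nil] := V0 k.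
rewrite /= /vertex (_ : slot 0 [::] psi = w) // aw.
by have [_ _ _ h /h] := leP k; exists k.
Qed.

Theorem theorem3p32 (R : realType) (P : topologicalType) (hP : polish R P)
    (le : quasi_order P) (hle : borel_quasi_order le) :
  (odimB_le_aleph0 le /\
     ~ (forall E : seq nat -> seq nat, selector E -> G0_map le E)) \/
  (~ odimB_le_aleph0 le /\
     (forall E : seq nat -> seq nat, selector E -> G0_map le E)).
Proof.
have [od|nod] := pselect (odimB_le_aleph0 le); [left|right]; split=> //.
  by move=> /(_ _ dense_selectorP); exact: countable_odim_no_dense_map.
move=> E selE; apply: contrapT => nG; apply: nod.
have [[D cD dD] [d [dm dc dcomp]]] := hP.
have [[x0 _]|nP] := pselect (exists x : P, True).
  have hausP := metric_compatible_hausdorff dm dc.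
  have susP := complete_metric_suslin dm dc cD dD dcomp x0.
  exact: not_G0_map_countable_odim hausP susP hle selE nG.
apply/(odimB_le_aleph0P hle); exists (fun=> le); split=> [n|x]; first by split.
by case: nP; exists x.
Qed.
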